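(* $\mathbf H_Q\cong U(\mathfrak n_Q)$ as Hopf algebras, where $\mathfrak n_Q\subset\mathbf H_Q$ is the Lie algebra of primitive elements, and $\mathfrak n_Q$ is the (pro-nilpotent) Lie algebra spanned by the elements $[M]$ with $M\in\mathrm{Iso}(Q)$ indecomposable. The same holds for the Hall algebra of the subcategory of nilpotent representations, with $\mathfrak n_Q$ spanned by the classes of indecomposable nilpotent representations.
   Context: Let $Q$ be a quiver and $\mathrm{Rep}(Q,\mathbb{F}_1)$ the category of representations $(V_i,f_h)$ over $\mathbb{F}_1$ (each $V_i$ a finite pointed set, each $f_h:V_{h'}\to V_{h''}$ a pointed map injective off the preimage of the base point); subrepresentations are families of subsets containing the base points stable under edge maps; quotients collapse subrepresentations to base points; direct sums are vertexwise, $V\oplus W=V\sqcup W$ with base points identified. A representation is indecomposable if it is nonzero and not a direct sum of two nonzero representations; it is nilpotent if all sufficiently long path compositions of edge maps are zero. $\mathrm{Iso}(Q)$ is the set of isomorphism classes (fixed representatives). $\mathbf H_Q$ is the space of finitely supported functions $\mathrm{Iso}(Q)\to\mathbb C$ with basis of delta functions $[M]$, product $(f\cdot g)(M)=\sum_{L\subset M}f(M/L)g(L)$ over subrepresentations $L$ of $M$, grading by dimension vector, and coproduct $\Delta([M])=\sum_{(A,B):A\oplus B\cong M}[A]\otimes[B]$. An element $x$ is primitive if $\Delta(x)=x\otimes1+1\otimes x$. *)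

(* Defs.v *)
From HB Require Import structures.
From mathcomp Require Import all_boot all_order all_algebra.
Set Implicit Arguments. Unset Strict Implicit. Unset Printing Implicit Defensive.
Import Order.TTheory GRing.Theory Num.Theory.

Record quiver := Quiver {
  qvert : finType; qarrow : finType;
  qsrc : qarrow -> qvert; qtgt : qarrow -> qvert }.

Section HallF1.
Variable Q : quiver.
Local Notation V := (qvert Q).
Local Notation E := (qarrow Q).
Local Notation src := (@qsrc Q).
Local Notation tgt := (@qtgt Q).

(* Raw representation data over F_1: the pointed set at vertex i is
   'I_(rdim i).+1 with base point ord0 (so rdim i = number of non-base
   points = dimension); rmap h : V_{src h} -> V_{tgt h}. *)
Record rep := Rep {
  rdim : V -> nat;
  rmap : forall h : E, 'I_(rdim (src h)).+1 -> 'I_(rdim (tgt h)).+1 }.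
Arguments rmap : clear implicits.

Definition valid (M : rep) : bool :=
  [forall h : E, (rmap M h ord0 == ord0) &&
     [forall x, forall y,
        ((rmap M h x == rmap M h y) && (rmap M h x != ord0)) ==> (x == y)]].

Definition isob (M N : rep) : bool :=
  [exists s : {dffun forall i : V, {ffun 'I_(rdim M i).+1 -> 'I_(rdim N i).+1}},
    [forall i, [&& rdim M i == rdim N i, injectiveb (s i) & s i ord0 == ord0]] &&
    [forall h, forall x, s (tgt h) (rmap M h x) == rmap N h (s (src h) x)]].

Definition isZero (M : rep) : bool := [forall i, rdim M i == 0%N].

Definition rep0 : rep := @Rep (fun _ => 0%N) (fun h _ => ord0).

(* Direct sum A (+) B = A |_| B with base points identified:
   0 is the base point, 1..dA are the points of A, dA+1..dA+dB those of B. *)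
Definition dsum (A B : rep) : rep :=
  @Rep (fun i => (rdim A i + rdim B i)%N)
   (fun h x => inord (
      let n := nat_of_ord x in
      if (n <= rdim A (src h))%N then nat_of_ord (rmap A h (inord n))
      else let z := nat_of_ord (rmap B h (inord (n - rdim A (src h)))) in
           if z == 0%N then 0%N else (rdim A (tgt h) + z)%N)).

(* Given subsets T i of the pointed sets of M (each containing the base point),
   the representation on the T i (renumbered increasingly, so base point stays
   0), where x is sent to rmap x if that lies in T, and to the base point
   otherwise.  Used for subrepresentations (T = L) and quotients
   (T = (M \ L) u {base}). *)
Definition restr (M : rep) (T : forall i : V, {set 'I_(rdim M i).+1}) : rep :=
  @Rep (fun i => (#|T i|.-1)%N)
   (fun h k => let y := nth ord0 (enum (T (src h))) k in
               let z := rmap M h y in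
               inord (index (if z \in T (tgt h) then z else ord0)
                            (enum (T (tgt h))))).

Definition subsets_of (M : rep) :=
  {dffun forall i : V, {set 'I_(rdim M i).+1}}.

Definition is_subrep (M : rep) (S : subsets_of M) : bool :=
  [forall i, ord0 \in S i] &&
  [forall h, forall x, (x \in S (src h)) ==> (rmap M h x \in S (tgt h))].

Definition sub (M : rep) (S : subsets_of M) : rep := @restr M (fun i => S i).
Definition quo (M : rep) (S : subsets_of M) : rep :=
  @restr M (fun i => ~: S i :|: [set ord0]).
Arguments is_subrep : clear implicits.
Arguments sub : clear implicits.
Arguments quo : clear implicits.
Arguments restr : clear implicits.

Fixpoint nz_after (M : rep) (k : nat) (i : V) (n : nat) : Prop :=
  match k with
  | 0 => n <> 0%N
  | k'.+1 => exists h : E, src h = i /\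
               nz_after M k' (tgt h) (nat_of_ord (rmap M h (inord n)))
  end.

Definition nilpotent (M : rep) : Prop :=
  exists N, forall k, (N <= k)%N ->
    forall i (x : 'I_(rdim M i).+1), ~ nz_after M k i x.

Definition indecomposable (M : rep) : Prop :=
  ~~ isZero M /\
  ~ (exists A B, [/\ valid A, valid B, ~~ isZero A, ~~ isZero B
                   & isob M (dsum A B)]).

Section Field.
Variable K : fieldType.
Local Open Scope ring_scope.

(* Elements of the Hall algebra H_P (P = full category, or nilpotent reps):
   functions on representations which vanish on non-representations and
   outside P, are isomorphism invariant (i.e. functions on Iso), and have
   finite support modulo isomorphism. *)
Definition inH (P : rep -> Prop) (f : rep -> K) : Prop :=
  [/\ forall M, ~~ valid M -> f M = 0,
      forall M, valid M -> ~ P M -> f M = 0,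
      forall M N, valid M -> valid N -> isob M N -> f M = f N
    & exists k (g : 'I_k -> rep),
        forall M, valid M -> f M != 0 -> exists j, isob M (g j)].

Definition hadd (f g : rep -> K) : rep -> K := fun M => f M + g M.
Definition hscale (a : K) (f : rep -> K) : rep -> K := fun M => a * f M.

Definition hmul (f g : rep -> K) : rep -> K := fun M =>
  if valid M then
    \sum_(S : subsets_of M | is_subrep M S) f (quo M S) * g (sub M S)
  else 0.

Definition hone : rep -> K := fun M => (valid M && isZero M)%:R.

Definition delta (N : rep) : rep -> K := fun M => (valid M && isob M N)%:R.

Definition hbr (x y : rep -> K) : rep -> K :=
  fun M => hmul x y M - hmul y x M.

Definition coprod (f : rep -> K) : rep -> rep -> K := fun A B =>
  if valid A && valid B then f (dsum A B) else 0.

(* Product on H (x) H (functions on pairs of isoclasses). *)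
Definition tmul (F G : rep -> rep -> K) : rep -> rep -> K := fun A B =>
  if valid A && valid B then
    \sum_(S : subsets_of A | is_subrep A S) \sum_(T : subsets_of B | is_subrep B T)
       F (quo A S) (quo B T) * G (sub A S) (sub B T)
  else 0.

Definition primitive (x : rep -> K) : Prop :=
  forall A B, valid A -> valid B ->
    coprod x A B = x A * hone B + hone A * x B.

Definition span_indec (P : rep -> Prop) (x : rep -> K) : Prop :=
  exists k (c : 'I_k -> K) (g : 'I_k -> rep),
    (forall j, [/\ valid (g j), P (g j) & indecomposable (g j)]) /\
    forall M, x M = \sum_(j < k) c j * delta (g j) M.

Definition alg_map_on (P : rep -> Prop) (A : algType K)
    (Phi : (rep -> K) -> A) : Prop :=
  [/\ Phi hone = 1,
      forall f g, inH P f -> inH P g -> Phi (hadd f g) = Phi f + Phi g,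
      forall a f, inH P f -> Phi (hscale a f) = a *: Phi f
    & forall f g, inH P f -> inH P g -> Phi (hmul f g) = Phi f * Phi g].

Definition lie_map_on (n : (rep -> K) -> Prop) (A : algType K)
    (phi : (rep -> K) -> A) : Prop :=
  (forall a x y, n x -> n y -> phi (hadd (hscale a x) y) = a *: phi x + phi y) /\
  (forall x y, n x -> n y -> phi (hbr x y) = phi x * phi y - phi y * phi x).

(* H_P, with the inclusion of n, is a universal enveloping algebra of n:
   every Lie map n -> A extends uniquely to an algebra map H_P -> A.
   (I.e. the canonical map U(n) -> H_P is an algebra isomorphism.) *)
Definition is_UEA (P : rep -> Prop) (n : (rep -> K) -> Prop) : Prop :=
  forall (A : algType K) (phi : (rep -> K) -> A), lie_map_on n phi ->
    (exists Phi, alg_map_on P Phi /\ forall x, n x -> Phi x = phi x) /\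
    (forall Phi1 Phi2, alg_map_on P Phi1 -> alg_map_on P Phi2 ->
       (forall x, n x -> Phi1 x = phi x) -> (forall x, n x -> Phi2 x = phi x) ->
       forall x, inH P x -> Phi1 x = Phi2 x).

(* Coproduct and counit (f |-> f([0])) are algebra maps, so that the canonical
   algebra isomorphism U(n) -> H_P (which sends n to primitives) is an
   isomorphism of bialgebras, hence of Hopf algebras. *)
Definition bialg_compat (P : rep -> Prop) : Prop :=
  [/\ forall f g, inH P f -> inH P g -> forall A B,
        coprod (hmul f g) A B = tmul (coprod f) (coprod g) A B,
      forall A B, coprod hone A B = hone A * hone B,
      forall f g, inH P f -> inH P g -> hmul f g rep0 = f rep0 * g rep0
    & hone rep0 = 1].

Definition hall_UEA_claim (P : rep -> Prop) : Prop :=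
  [/\ forall x, (inH P x /\ primitive x) <-> span_indec P x,
      is_UEA P (fun x => inH P x /\ primitive x)
    & bialg_compat P].

End Field.
End HallF1.

(* Main.v *)
(** The number of direct summands filters the Hall algebra. If [x] is primitive
    then [x * g] on [A (+) B] obeys a Leibniz rule, so a product of [k] classes
    of indecomposables vanishes on every sum of more than [k] non-zero
    representations, and its value on a sum of exactly [k] of them counts the
    bijections matching isomorphic factors. In characteristic 0 this number is
    invertible as soon as it is non-zero. Hence, by descending the filtration,
    words in the indecomposables span the algebra; and since a permuted word
    differs from the original one by shorter words, in the target of a Lie map
    just as in the Hall algebra, a linear relation between words in the Hall
    algebra also holds in the target. So a Lie map extends to the Hall algebra
    by its values on words. Primitivity of [x] says that [x] vanishes at 0 and
    on decomposables, which identifies the primitive elements. *)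

Require Import Defs.
From HB Require Import structures.
From mathcomp Require Import all_boot all_order all_algebra ring.
From Stdlib Require List.
From Stdlib Require Import FunctionalExtensionality ClassicalEpsilon.
Import GRing.Theory.
Set Implicit Arguments.
Unset Strict Implicit.
Unset Printing Implicit Defensive.
Local Open Scope nat_scope.

(** * Representations as graphs *)

(** The universal property is tested against an arbitrary target, so the obstacle is
    well-definedness: the indecomposables carry no order, and there is no PBW normal form on which
    an extension could be defined. The extension therefore starts as a relation, [words], pairing a
    combination of words in the Hall algebra with the same combination in the target, and the point
    to prove is that it pairs 0 only with 0. Counting matchings plays the part of linear
    independence: among words of one length, evaluation at the sum of the letters of [w] detects
    exactly the words that permute [w] up to isomorphism. The count is a product of factorials of
    multiplicities, for instance [k!] for the k-th power of one class; this is where characteristic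
    0 enters. *)

Section Graphs.
Variable Q : quiver.
Local Notation V := (qvert Q).
Local Notation E := (qarrow Q).
Local Notation src := (@qsrc Q).
Local Notation tgt := (@qtgt Q).

(* Subrepresentations and quotients of a representation realize subsets of the
   vertices of one fixed graph, so that iterating them (as associativity
   requires) does not change the ambient type. *)
Record graph := Graph {
  gpt :> finType;
  gvert : gpt -> V;
  garr : E -> rel gpt;
  garr_src : forall h x y, garr h x y -> gvert x = src h;
  garr_tgt : forall h x y, garr h x y -> gvert y = tgt h;
  garr_fun : forall h x y z, garr h x y -> garr h x z -> y = z;
  garr_inj : forall h x y z, garr h x z -> garr h y z -> x = y }.

(** Points are handled as natural numbers because the ordinal type depends on the vertex; equations
    between vertices then rewrite without transport. *)
Definition rmapn (M : rep Q) (h : E) (n : nat) : nat :=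
  rmap (r := M) (h := h) (inord n).

Definition basepreserving (M : rep Q) := forall h, rmap (r := M) (h := h) ord0 = ord0.

Lemma valid_base M : valid M -> basepreserving M.
Proof. by move=> /forallP H h; have /andP[/eqP] := H h. Qed.

Lemma valid_inj M h (x y : 'I_(rdim M (src h)).+1) :
  valid M -> rmap x = rmap y -> rmap x <> ord0 -> x = y.
Proof.
move=> /forallP H e n; have /andP[_ /forallP/(_ x)/forallP/(_ y)] := H h.
by move/implyP=> H'; apply/eqP/H'; rewrite e eqxx -e; apply/eqP.
Qed.

Lemma validP M : basepreserving M ->
  (forall h (x y : 'I_(rdim M (src h)).+1),
     rmap x = rmap y -> rmap x <> ord0 -> x = y) -> valid M.
Proof.
move=> H0 H; apply/forallP=> h; rewrite H0 eqxx /=.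
apply/forallP=> x; apply/forallP=> y; apply/implyP=> /andP[/eqP e /eqP n].
by apply/eqP/H.
Qed.

Lemma inord0 n : inord 0 = ord0 :> 'I_n.+1.
Proof. by apply: val_inj; rewrite /= inordK. Qed.

Lemma rmapn0 M h : basepreserving M -> rmapn M h 0 = 0.
Proof. by move=> H; rewrite /rmapn inord0 H. Qed.

Lemma rmapn_le M h n : rmapn M h n <= rdim M (tgt h).
Proof. by rewrite -ltnS; exact: ltn_ord. Qed.

(* [e] numbers the points of [U] over each vertex from 1; 0 is the base point. *)
Record models (M : rep Q) (G : graph) (U : {set G}) (e : G -> nat) : Prop := Models {
  mod_base : basepreserving M;
  mod_bound : forall x, x \in U -> 0 < e x <= rdim M (gvert x);
  mod_inj : forall x y, x \in U -> y \in U -> gvert x = gvert y -> e x = e y -> x = y;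
  mod_surj : forall i n, 0 < n <= rdim M i -> exists x, [/\ x \in U, gvert x = i & e x = n];
  mod_arr : forall h x y, x \in U -> y \in U -> gvert x = src h -> gvert y = tgt h ->
     garr h x y = (rmapn M h (e x) == e y) }.

(** A value off the base point numbers some point of [U], so two arguments sharing it number points
    with arrows to the same target; [garr_inj] identifies them. *)
Lemma models_valid M G U e : @models M G U e -> valid M.
Proof.
move=> m; apply: validP; first exact: mod_base m.
move=> h x y exy nx.
have nz (z : 'I_(rdim M (src h)).+1) : rmap z <> ord0 -> 0 < z <= rdim M (src h).
  move=> nz; rewrite lt0n -[z <= _]ltnS ltn_ord andbT; apply/eqP=> z0; apply: nz.
  by have -> : z = ord0; [apply: val_inj | rewrite (mod_base m)].
have ny : rmap y <> ord0 by rewrite -exy.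
have [a [aU va ea]] := mod_surj m (nz _ nx).
have [b [bU vb eb]] := mod_surj m (nz _ ny).
have [c [cU vc ec]] : exists c, [/\ c \in U, gvert c = tgt h & e c = rmap x].
  apply: (mod_surj m); rewrite lt0n -[_ <= rdim _ _]ltnS ltn_ord andbT.
  by apply/eqP=> z0; apply: nx; apply: val_inj.
have ha : garr h a c by rewrite (mod_arr m) // /rmapn ea ec inord_val.
have hb : garr h b c by rewrite (mod_arr m) // /rmapn eb ec inord_val exy.
by apply: val_inj; rewrite /= -ea -eb (garr_inj ha hb).
Qed.

Definition fib (G : graph) (U : {set G}) i := [set x in U | gvert x == i].

Lemma models_dim M G U e : @models M G U e -> forall i, rdim M i = #|fib U i|.
Proof.
move=> m i; rewrite cardE -(size_map e) -[LHS](size_iota 1).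
apply: perm_size; apply: uniq_perm; first exact: iota_uniq.
  rewrite map_inj_in_uniq ?enum_uniq // => x y.
  rewrite !mem_enum !inE => /andP[xU /eqP vx] /andP[yU /eqP vy].
  by apply: (mod_inj m); rewrite ?vx ?vy.
move=> n; rewrite mem_iota add1n ltnS.
apply/idP/mapP => [/(mod_surj m)[x [xU vx <-]]|[x]].
  by exists x => //; rewrite mem_enum inE xU vx eqxx.
by rewrite mem_enum inE => /andP[xU /eqP<-] ->; exact: (mod_bound m).
Qed.

(** The renumbering from [e] to [e'] is an isomorphism. Every isomorphism constructed below arises
    from such a common model, directly or by composition. *)
Lemma models_iso M N G U e e' :
  @models M G U e -> @models N G U e' -> isob M N.
Proof.
move=> m n.
have dE i : rdim M i = rdim N i by rewrite (models_dim m) (models_dim n).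
pose s0 i k : nat := if [pick x in U | (gvert x == i) && (e x == k)] is Some x then e' x else 0.
have s0E x : x \in U -> s0 (gvert x) (e x) = e' x.
  move=> xU; rewrite /s0; case: pickP => [y /and3P[yU /eqP vy /eqP ey]|/(_ x)].
    by rewrite (mod_inj m yU xU vy ey).
  by rewrite xU !eqxx.
have s00 i : s0 i 0 = 0.
  rewrite /s0; case: pickP => // y /and3P[yU _ /eqP ey].
  by have := mod_bound m yU; rewrite ey.
have s0le i k : s0 i k <= rdim N i.
  by rewrite /s0; case: pickP => // y /and3P[yU /eqP<- _]; have /andP[] := mod_bound n yU.
pose s : {dffun forall i : V, {ffun 'I_(rdim M i).+1 -> 'I_(rdim N i).+1}} :=
  finfun (fun i => [ffun k : 'I_(rdim M i).+1 => inord (s0 i k) : 'I_(rdim N i).+1]).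
have sE i (k : 'I_(rdim M i).+1) : s i k = s0 i k :> nat.
  by rewrite !ffunE /= inordK // ltnS.
apply/existsP; exists s; apply/andP; split; apply/forallP.
  move=> i; apply/and3P; split; first (by apply/eqP); last first.
    by rewrite -val_eqE /= sE s00.
  apply/injectiveP => k l /(congr1 (@nat_of_ord _)); rewrite !sE => ekl; apply: val_inj => /=.
  have le (p : 'I_(rdim M i).+1) : 0 < p -> 0 < p <= rdim M i by move=> ->; rewrite -ltnS /=.
  have pos (p : 'I_(rdim M i).+1) : 0 < p -> 0 < s0 i p.
    move=> /le/(mod_surj m)[x [xU vx <-]]; rewrite -vx s0E //.
    by case/andP: (mod_bound n xU).
  case: (posnP k) (pos k) => [k0 _|k1 /(_ isT) k2].
    case: (posnP l) (pos l) => [l0 _|l1 /(_ isT)]; first by rewrite k0 l0.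
    by rewrite -ekl k0 s00.
  case: (posnP l) ekl => [->|l1]; first by rewrite s00 => e0; rewrite e0 in k2.
  have [x [xU vx ex]] := mod_surj m (le _ k1).
  have [y [yU vy ey]] := mod_surj m (le _ l1).
  rewrite -ex -ey -{1}vx -vy !s0E // => exy.
  by congr e; apply: (mod_inj n) => //; rewrite vx.
move=> h; apply/forallP=> k; rewrite -val_eqE /= sE.
have [k0|k1] := posnP k.
  have -> : k = ord0 by apply: val_inj.
  rewrite (mod_base m) s00.
  suff -> : s (src h) ord0 = ord0 by rewrite (mod_base n).
  by apply: val_inj; rewrite /= sE s00.
have [|x [xU vx ex]] := mod_surj m (i := src h) (n := k); first by rewrite k1 -ltnS /=.
have sx : s (src h) k = inord (e' x).
  by apply: val_inj; rewrite /= sE -ex -vx s0E // vx inordK // ltnS -vx; case/andP: (mod_bound n xU).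
rewrite sx -[k]inord_val -ex -/(rmapn M h _) -/(rmapn N h _).
(* If the edge kills [x] in [M], it does so in [N]: a non-zero value in [N] would number the end of
   an arrow from [x], and [M] has the same arrows. *)
have [z0|z1] := posnP (rmapn M h (e x)).
  rewrite z0 s00 eq_sym; apply: contraT; rewrite -lt0n => z1.
  have [|y [yU vy ey]] := mod_surj n (i := tgt h) (n := rmapn N h (e' x)).
    by rewrite z1 rmapn_le.
  have := mod_arr n xU yU vx vy; rewrite ey eqxx (mod_arr m) // z0 => /eqP ey0.
  by have := mod_bound m yU; rewrite -ey0.
have [|y [yU vy ey]] := mod_surj m (i := tgt h) (n := rmapn M h (e x)).
  by rewrite z1 rmapn_le.
rewrite -ey -{1}vy s0E // eq_sym.
by rewrite -(mod_arr n) // (mod_arr m) // ey.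
Qed.

(** Converse of [models_iso]: an isomorphism changes only the numbering. Being isomorphic thus means
    having a common model, from which transitivity and invariance follow at once. *)
Lemma models_isob M N G U e : @models M G U e -> isob M N -> exists e', @models N G U e'.
Proof.
move=> m /existsP[s /andP[/forallP H1 /forallP H2]].
have dE i : rdim M i = rdim N i by have /and3P[/eqP] := H1 i.
have sinj i : injective (s i) by have /and3P[_ /injectiveP] := H1 i.
have s0 i : s i ord0 = ord0 by have /and3P[_ _ /eqP] := H1 i.
have sh h x : s (tgt h) (rmap x) = rmap (s (src h) x).
  by have /forallP/(_ x)/eqP := H2 h.
have le x : x \in U -> e x < (rdim M (gvert x)).+1 by rewrite ltnS => /(mod_bound m)/andP[].
exists (fun x => nat_of_ord (s (gvert x) (inord (e x)))); split.
- by move=> h; rewrite -(s0 (src h)) -sh (mod_base m) s0.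
- move=> x xU; rewrite -[_ <= rdim _ _]ltnS ltn_ord andbT lt0n; apply/eqP=> /= s00.
  have : s (gvert x) (inord (e x)) = s (gvert x) ord0 by apply: val_inj; rewrite s0.
  move/sinj/(congr1 val) => /=; rewrite inordK ?le // => e0.
  by have := mod_bound m xU; rewrite e0.
- move=> x y xU yU vxy; have := le y yU; have := le x xU; rewrite vxy => lx ly /val_inj/sinj/(congr1 val) /=.
  by rewrite !inordK // => /(mod_inj m); exact.
- move=> i n /andP[n0 nle].
  have /mapP[k _ nk] : (inord n : 'I_(rdim N i).+1) \in [seq s i k | k : 'I_(rdim M i).+1].
    by apply: (inj_card_onto (sinj i)); rewrite !card_ord dE.
  have [|x [xU vx ex]] := mod_surj m (i := i) (n := k).
    rewrite -[_ <= rdim _ _]ltnS ltn_ord andbT lt0n; apply/eqP=> k0.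
    move: nk; have -> : k = ord0 by apply: val_inj.
    by move=> /(congr1 val); rewrite s0 /= inordK // => n00; rewrite n00 in n0.
  exists x; split=> //; rewrite vx ex inord_val -nk inordK //.
- move=> h x y xU yU vx vy; rewrite (mod_arr m) // vx vy /rmapn inord_val -sh.
  rewrite [RHS](inj_eq val_inj) (inj_eq (sinj _)) -val_eqE /= inordK //.
  by rewrite -vy le.
Qed.

Lemma models_pull M (G G' : graph) (U : {set G}) (U' : {set G'}) e (phi : G -> G') :
  @models M G' U' e -> {in U &, injective phi} -> phi @: U = U' ->
  {in U, forall x, gvert (phi x) = gvert x} ->
  {in U &, forall x y h, garr h (phi x) (phi y) = garr h x y} ->
  @models M G U (e \o phi).
Proof.
move=> m pi pU pv pa.
have pin x : x \in U -> phi x \in U' by move=> xU; rewrite -pU imset_f.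
split=> /=; first exact: (mod_base m).
- by move=> x xU; rewrite -pv // (mod_bound m) // pin.
- move=> x y xU yU vxy exy; apply: pi => //.
  by apply: (mod_inj m) => //; rewrite ?pin // !pv.
- move=> i n /(mod_surj m)[x' []]; rewrite -pU => /imsetP[x xU ->]; rewrite pv // => vx ex.
  by exists x.
- by move=> h x y xU yU vx vy; rewrite -pa // (mod_arr m) ?pin ?pv.
Qed.
End Graphs.

(** * From representations to graphs and back *)

Section Realizations.
Variable Q : quiver.
Local Notation V := (qvert Q).
Local Notation E := (qarrow Q).
Local Notation src := (@qsrc Q).
Local Notation tgt := (@qtgt Q).
Local Notation graph := (graph Q).

Section GraphOf.
Variables (M : rep Q) (vM : valid M).
(** Only non-base points: the ordinal [k] stands for the point numbered [k.+1]. *)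
Definition rep_pt : finType := {i : V & 'I_(rdim M i)}.
Definition rep_arr h (x y : rep_pt) :=
  [&& tag x == src h, tag y == tgt h & rmapn M h (tagged x).+1 == (tagged y).+1].

Lemma rep_pt_eq (x y : rep_pt) : tag x = tag y -> tagged x = tagged y :> nat -> x = y.
Proof.
by case: x y => [i x] [j y] /= eij; case: _ / eij y => y /val_inj->.
Qed.

Lemma rep_arr_inj h (x y z : rep_pt) : rep_arr h x z -> rep_arr h y z -> x = y.
Proof.
move=> /and3P[/eqP vx _ /eqP ex] /and3P[/eqP vy _ /eqP ey].
apply: rep_pt_eq; first by rewrite vx.
have lx : (tagged x).+1 < (rdim M (src h)).+1 by rewrite ltnS -vx.
have ly : (tagged y).+1 < (rdim M (src h)).+1 by rewrite ltnS -vy.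
have e : inord (tagged x).+1 = inord (tagged y).+1 :> 'I_(rdim M (src h)).+1.
  apply: (valid_inj vM); first by apply: val_inj; rewrite /= [LHS]ex [RHS]ey.
  by move/(congr1 val); rewrite /= [LHS]ex.
by have := congr1 val e; rewrite /= !inordK // => -[].
Qed.

Definition graph_of : graph := @Graph Q rep_pt (@tag _ _) rep_arr
  (fun h x y H => let: And3 e _ _ := and3P H in eqP e)
  (fun h x y H => let: And3 _ e _ := and3P H in eqP e)
  (fun h x y z H1 H2 => let: And3 _ v1 e1 := and3P H1 in let: And3 _ v2 e2 := and3P H2 in
     rep_pt_eq (etrans (eqP v1) (esym (eqP v2)))
      (succn_inj (etrans (esym (eqP e1)) (eqP e2))))
  rep_arr_inj.

Lemma models_graph_of : @models Q M graph_of setT (fun x => (tagged (x : rep_pt)).+1).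
Proof.
split; first exact: valid_base.
- by move=> x _ /=.
- by move=> x y _ _ /= v [e]; exact: rep_pt_eq.
- move=> i [|n] // nle; exists (Tagged (fun i => 'I_(rdim M i)) (Ordinal nle) : rep_pt).
  by split; rewrite ?inE.
- by move=> h x y _ _ /= vx vy; rewrite /rep_arr; move/eqP: vx => ->; move/eqP: vy => ->.
Qed.
End GraphOf.

Section Real.
Variables (G : graph) (U : {set G}).
Definition lab (x : G) := (index x (enum (fib U (gvert x)))).+1.
(** A chosen representative for each set of points. It turns an invariant function of
    representations into a function of sets, over which sums can be reindexed. *)
Definition real : rep Q := @Rep Q (fun i => #|fib U i|) (fun h k => inord
  (if [pick p : G * G | [&& p.1 \in U, p.2 \in U, garr h p.1 p.2 & lab p.1 == k]]
   is Some p then lab p.2 else 0)).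

Lemma lab_inj x y : x \in U -> y \in U -> gvert x = gvert y -> lab x = lab y -> x = y.
Proof.
move=> xU yU vxy []; rewrite vxy => e.
have xin : x \in enum (fib U (gvert y)) by rewrite mem_enum inE xU vxy eqxx.
have yin : y \in enum (fib U (gvert y)) by rewrite mem_enum inE yU eqxx.
by rewrite -(nth_index x xin) e nth_index.
Qed.

Lemma lab_le x : x \in U -> lab x <= #|fib U (gvert x)|.
Proof. by move=> xU; rewrite cardE index_mem mem_enum inE xU eqxx. Qed.

Lemma models_real : @models Q real G U lab.
Proof.
split.
- move=> h; rewrite /real /=; case: pickP => [p /and4P[_ _ _]|_] //=.
  by rewrite inord0.
- by move=> x xU /=; exact: lab_le.
- exact: lab_inj.
- move=> i [|n] //= nle.
  pose x := enum_val (Ordinal nle).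
  have := enum_valP (Ordinal nle); rewrite -/x inE => /andP[xU /eqP vx].
  exists x; split => //; rewrite /lab vx /x (enum_val_nth x) index_uniq ?enum_uniq //.
  by rewrite -cardE.
- move=> h x y xU yU vx vy; rewrite /rmapn /=.
  have l : lab x < #|fib U (src h)|.+1 by rewrite ltnS -vx lab_le.
  have ly : lab y <= #|fib U (tgt h)| by rewrite -vy lab_le.
  case: pickP => [[a b] /= /and4P[aU bU hab]|H].
    rewrite inordK // => /eqP ea.
    have eax : a = x by apply: lab_inj; rewrite // vx (garr_src hab).
    subst a.
    rewrite inordK; last by rewrite ltnS -(garr_tgt hab) lab_le.
    apply/idP/eqP => [hxy|e]; first by rewrite (garr_fun hab hxy).
    by rewrite -(lab_inj bU yU _ e) // vy (garr_tgt hab).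
  rewrite inord0 /=; apply: contraFF (H (x, y)) => /= hxy.
  by rewrite xU yU hxy inordK ?eqxx.
Qed.

Lemma real_valid : valid real.
Proof. exact: models_valid models_real. Qed.
End Real.

Lemma isob_valid (M N : rep Q) : valid M -> isob M N -> valid N.
Proof.
move=> vM i; have [e m] := models_isob (models_graph_of vM) i.
exact: models_valid m.
Qed.

Lemma isob_refl (M : rep Q) : valid M -> isob M M.
Proof. by move=> vM; apply: models_iso (models_graph_of vM) (models_graph_of vM). Qed.

Lemma isob_sym (M N : rep Q) : valid M -> isob M N -> isob N M.
Proof.
move=> vM i; have [e m] := models_isob (models_graph_of vM) i.
exact: models_iso m (models_graph_of vM).
Qed.

Lemma isob_trans (M N L : rep Q) : valid M -> isob M N -> isob N L -> isob M L.
Proof.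
move=> vM i j; have [e m] := models_isob (models_graph_of vM) i.
have [e' m'] := models_isob m j; exact: models_iso (models_graph_of vM) m'.
Qed.

Lemma isob_dim (M N : rep Q) i : isob M N -> rdim M i = rdim N i.
Proof. by case/existsP=> s /andP[/forallP/(_ i)/and3P[/eqP]]. Qed.

Lemma isZeroP (M : rep Q) : reflect (forall i, rdim M i = 0) (isZero M).
Proof. by apply: (iffP forallP) => H i; apply/eqP; rewrite H. Qed.

Lemma isob_zero (M N : rep Q) : isob M N -> isZero M = isZero N.
Proof.
by move=> i; apply/isZeroP/isZeroP => H j; rewrite -(H j) (isob_dim j i).
Qed.

Lemma models_zero (M : rep Q) G U e : @models Q M G U e -> isZero M = (U == set0).
Proof.
move=> m; apply/isZeroP/eqP => [H|U0 i].
  apply/setP=> x; rewrite inE; apply/negP=> xU.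
  by have := mod_bound m xU; rewrite H => /andP[]; case: (e x).
by rewrite (models_dim m) U0; apply: eq_card0 => x; rewrite !inE.
Qed.

Section Restr.
Variables (M : rep Q) (T : forall i, {set 'I_(rdim M i).+1}).
Hypothesis T0 : forall i, ord0 \in T i.

Lemma restr_size i : (#|T i|.-1).+1 = #|T i|.
Proof. by apply: prednK; apply/card_gt0P; exists ord0; exact: T0. Qed.

(** The enumeration is increasing, so the base point keeps the number 0. *)
Lemma index_base i : index ord0 (enum (T i)) = 0.
Proof. by rewrite {1}/enum_mem -enumT enum_ordSl /= T0. Qed.

Lemma index_restr i x : x \in T i -> index x (enum (T i)) < (#|T i|.-1).+1.
Proof. by move=> xT; rewrite restr_size cardE index_mem mem_enum. Qed.

Lemma restr_rmapn h (y : 'I_(rdim M (src h)).+1) : y \in T (src h) ->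
  rmapn (restr T) h (index y (enum (T (src h)))) =
  index (if rmap y \in T (tgt h) then rmap y else ord0) (enum (T (tgt h))).
Proof.
move=> yT; rewrite /rmapn /= ![X in nth _ _ X]inordK ?index_restr // !nth_index ?mem_enum //.
by case: ifP => z; rewrite inordK ?index_restr ?T0.
Qed.

(** Restriction keeps exactly the arrows with both ends in [T], whether or not [T] is stable; this
    treats subrepresentations and quotients together. *)
Lemma models_restr G U e : @models Q M G U e ->
  @models Q (restr T) G [set x in U | inord (e x) \in T (gvert x)]
     (fun x => index (inord (e x) : 'I_(rdim M (gvert x)).+1) (enum (T (gvert x)))).
Proof.
move=> m; have idx_inj i (a b : 'I_(rdim M i).+1) : a \in T i -> b \in T i ->
    index a (enum (T i)) = index b (enum (T i)) -> a = b.
  move=> aT bT eab; have := nth_index ord0 (_ : a \in enum (T i)).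
  by rewrite eab nth_index ?mem_enum // => ->.
have le x : x \in U -> e x < (rdim M (gvert x)).+1 by rewrite ltnS => /(mod_bound m)/andP[].
split.
- move=> h; rewrite -{1}inord0; apply: val_inj; rewrite /= -/(rmapn (restr T) h 0).
  by rewrite -(index_base (src h)) restr_rmapn // (mod_base m) T0 !index_base.
- move=> x; rewrite inE => /andP[xU xT]; rewrite -[_ <= rdim _ _]ltnS /= index_restr // andbT.
  rewrite lt0n -(index_base (gvert x)); apply/eqP=> /(idx_inj _ _ _ xT (T0 _)) /(congr1 val).
  by rewrite /= inordK ?le // => e0; have := mod_bound m xU; rewrite e0.
- move=> x y; rewrite !inE => /andP[xU xT] /andP[yU yT] vxy.
  have := le _ xU; move: xT; rewrite vxy => xT lx /(idx_inj _ _ _ xT yT) /(congr1 val) /=.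
  by rewrite !inordK ?le //; exact: (mod_inj m).
- move=> i n /= /andP[n0 nle].
  have nlt : n < size (enum (T i)) by rewrite -cardE -restr_size ltnS.
  pose k := nth ord0 (enum (T i)) n.
  have kT : k \in T i by rewrite -mem_enum mem_nth.
  have ik : index k (enum (T i)) = n by rewrite index_uniq ?enum_uniq.
  have [|x [xU vx ex]] := mod_surj m (i := i) (n := k).
    rewrite -[_ <= rdim _ _]ltnS ltn_ord andbT lt0n; apply/eqP=> k0.
    move: n0; rewrite -ik; have -> : k = ord0 by apply: val_inj.
    by rewrite index_base.
  exists x; rewrite inE xU vx ex inord_val kT; split => //.
- move=> h x y; rewrite !inE => /andP[xU xT] /andP[yU yT] vx vy.
  rewrite (mod_arr m) //; move: xT yT (le _ yU); rewrite vx vy => xT yT ly.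
  rewrite restr_rmapn // /rmapn.
  case: ifP => z.
    apply/eqP/eqP=> [exy|/idx_inj]; first by rewrite -exy inord_val.
    by move=> ->; rewrite ?inordK.
  rewrite index_base; apply/eqP/eqP => [exy|]; first by rewrite -exy inord_val z in yT.
  rewrite -(index_base (tgt h)) => /(idx_inj _ _ _ (T0 _) yT)/(congr1 val) /=.
  by rewrite inordK // => e0; have := mod_bound m yU; rewrite -e0.
Qed.
End Restr.

Section Sum.
Variables GA GB : graph.
Definition sum_vert (x : GA + GB) := match x with inl a => gvert a | inr b => gvert b end.
Definition sum_arr h (x y : GA + GB) := match x, y with
  | inl a, inl b => garr h a b | inr a, inr b => garr h a b | _, _ => false end.
Definition gsum : graph.
Proof.
apply: (@Graph Q (GA + GB)%type sum_vert sum_arr).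
- by move=> h [x|x] [y|y] //= /garr_src.
- by move=> h [x|x] [y|y] //= /garr_tgt.
- by move=> h [x|x] [y|y] [z|z] //= a b; rewrite (garr_fun a b).
- by move=> h [x|x] [y|y] [z|z] //= a b; rewrite (garr_inj a b).
Defined.
Definition ssum (A : {set GA}) (B : {set GB}) : {set gsum} :=
  [set x : GA + GB | match x with inl a => a \in A | inr b => b \in B end].
Definition lsum (A : rep Q) (eA : GA -> nat) (eB : GB -> nat) (x : gsum) : nat :=
  match x with inl a => eA a | inr b => rdim A (gvert b) + eB b end.

Lemma dsum_rmapl (A B : rep Q) h n : n <= rdim A (src h) ->
  rmapn (dsum A B) h n = rmapn A h n.
Proof.
move=> nle; have E : (inord n : 'I_(rdim A (src h) + rdim B (src h)).+1) = n :> nat.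
  by rewrite inordK // ltnS (leq_trans nle) ?leq_addr.
by rewrite /rmapn /= E nle inordK // ltnS (leq_trans _ (leq_addr _ _)) // -ltnS.
Qed.

Lemma dsum_rmapr (A B : rep Q) h n : 0 < n <= rdim B (src h) ->
  rmapn (dsum A B) h (rdim A (src h) + n) =
  if rmapn B h n == 0 then 0 else rdim A (tgt h) + rmapn B h n.
Proof.
move=> /andP[n0 nle].
have E : (inord (rdim A (src h) + n) : 'I_(rdim A (src h) + rdim B (src h)).+1)
    = rdim A (src h) + n :> nat by rewrite inordK // ltnS leq_add2l.
have lF : (rdim A (src h) + n <= rdim A (src h)) = false.
  by rewrite leqNgt -[X in X < _]addn0 ltn_add2l n0.
rewrite /rmapn /= E lF addKn.
by case: ifP => z; rewrite inordK // ltnS leq_add2l -ltnS.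
Qed.

Lemma models_dsum A B UA UB eA eB : @models Q A GA UA eA -> @models Q B GB UB eB ->
  @models Q (dsum A B) gsum (ssum UA UB) (lsum A eA eB).
Proof.
move=> mA mB; have bA := mod_base mA; have bB := mod_base mB.
split.
- move=> h; have e0 : rmapn (dsum A B) h 0 = 0 by rewrite dsum_rmapl // rmapn0.
  by apply: val_inj; rewrite -[RHS]e0 /rmapn inord0.
- case=> [x|x]; rewrite inE /=.
    by move=> /(mod_bound mA)/andP[-> /leq_trans->] //; rewrite leq_addr.
  by move=> /(mod_bound mB)/andP[x0 xle]; rewrite leq_add2l xle addn_gt0 x0 orbT.
- case=> [x|x] [y|y]; rewrite !inE /= => xU yU v.
  + by move/(mod_inj mA xU yU v)->.
  + move=> e; have := mod_bound mA xU; rewrite e v -{3}[rdim A _]addn0 leq_add2l.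
    by have /andP[] := mod_bound mB yU; case: (eB y) => // n; rewrite andbF.
  + move=> e; have := mod_bound mA yU; rewrite -e -v -{3}[rdim A _]addn0 leq_add2l.
    by have /andP[] := mod_bound mB xU; case: (eB x) => // n; rewrite andbF.
  + by rewrite v => /addnI /(mod_inj mB xU yU v)->.
- move=> i n /= /andP[n0 nle]; have [nA|nA] := leqP n (rdim A i).
    have [|x [xU vx ex]] := mod_surj mA (i := i) (n := n); first by rewrite n0.
    by exists (inl x); rewrite inE.
  have [|x [xU vx ex]] := mod_surj mB (i := i) (n := n - rdim A i).
    by rewrite subn_gt0 nA leq_subLR.
  by exists (inr x); rewrite inE /= vx ex subnKC // ltnW.
- move=> h [x|x] [y|y]; rewrite !inE /= => xU yU vx vy.
  + by rewrite dsum_rmapl -?vx ?(mod_arr mA) //; case/andP: (mod_bound mA xU).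
  + rewrite dsum_rmapl -?vx; last by case/andP: (mod_bound mA xU).
    apply/esym/eqP=> e; have := rmapn_le A h (eA x); rewrite e vy -{2}[rdim A _]addn0 leq_add2l.
    by have /andP[] := mod_bound mB yU; case: (eB y).
  + have := mod_bound mB xU; rewrite vx => bx; rewrite dsum_rmapr //.
    apply/esym/eqP; case: ifP => z e.
      by have := mod_bound mA yU; rewrite -e.
    have := mod_bound mA yU; rewrite -e vy -{3}[rdim A _]addn0 leq_add2l leqn0 z.
    by rewrite andbF.
  + have := mod_bound mB xU; rewrite vx => bx; rewrite dsum_rmapr // (mod_arr mB) //.
    have := mod_bound mB yU => /andP[y0 _]; rewrite vy.
    case: ifP => z; last by rewrite eqn_add2l.
    rewrite (eqP z) !(eq_sym 0); by case: (eB y) y0 => // n; rewrite addnS.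
Qed.
End Sum.
End Realizations.

(** * Direct sums, Hall product and subobjects *)

Section DsumIso.
Variable Q : quiver.
Local Notation graph := (graph Q).

Lemma ssumT (GA GB : graph) : ssum [set: GA] [set: GB] = setT.
Proof. by apply/setP=> -[x|x]; rewrite !inE. Qed.

Lemma models_dsumT (A B : rep Q) (vA : valid A) (vB : valid B) :
  exists e, @models Q (dsum A B) (gsum (graph_of vA) (graph_of vB)) setT e.
Proof.
rewrite -ssumT; eexists; apply: models_dsum; exact: models_graph_of.
Qed.

Lemma dsum_valid (A B : rep Q) : valid A -> valid B -> valid (dsum A B).
Proof. by move=> vA vB; have [e] := models_dsumT vA vB; exact: models_valid. Qed.

Lemma dsum_iso (A A' B B' : rep Q) : valid A -> valid B -> isob A A' -> isob B B' ->
  isob (dsum A B) (dsum A' B').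
Proof.
move=> vA vB iA iB; have mA := models_graph_of vA; have mB := models_graph_of vB.
have [eA mA'] := models_isob mA iA; have [eB mB'] := models_isob mB iB.
apply: models_iso (models_dsum mA mB) (models_dsum mA' mB').
Qed.

Lemma isZero_dsum (A B : rep Q) : isZero (dsum A B) = isZero A && isZero B.
Proof.
apply/isZeroP/andP => [H|[/isZeroP HA /isZeroP HB] i /=]; last by rewrite HA HB.
by split; apply/isZeroP=> i; move/eqP: (H i); rewrite /= addn_eq0 => /andP[/eqP? /eqP?].
Qed.

Lemma zero_pt (A : rep Q) (vA : valid A) (x : graph_of vA) : isZero A -> False.
Proof. by case: x => i x /isZeroP/(_ i) H; case: x; rewrite H. Qed.

Lemma dsum_zerol (A B : rep Q) : valid A -> valid B -> isZero A -> isob (dsum A B) B.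
Proof.
move=> vA vB A0; have [e m] := models_dsumT vA vB.
have m' := models_pull (phi := inr : graph_of vB -> gsum (graph_of vA) _) (U := setT) m.
apply: (models_iso (m' _ _ _ _) (models_graph_of vB)) => //.
  by move=> x y _ _ [].
apply/setP=> -[x|x]; first by case: (zero_pt x A0).
by rewrite inE; apply/imsetP; exists x.
Qed.

Lemma dsum_zeror (A B : rep Q) : valid A -> valid B -> isZero B -> isob (dsum A B) A.
Proof.
move=> vA vB B0; have [e m] := models_dsumT vA vB.
have m' := models_pull (phi := inl : graph_of vA -> gsum _ (graph_of vB)) (U := setT) m.
apply: (models_iso (m' _ _ _ _) (models_graph_of vA)) => //.
  by move=> x y _ _ [].
apply/setP=> -[x|x]; last by case: (zero_pt x B0).
by rewrite inE; apply/imsetP; exists x.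
Qed.

Lemma dsumA (A B C : rep Q) : valid A -> valid B -> valid C ->
  isob (dsum (dsum A B) C) (dsum A (dsum B C)).
Proof.
move=> vA vB vC; have mA := models_graph_of vA; have mB := models_graph_of vB.
have mC := models_graph_of vC.
pose GA := graph_of vA; pose GB := graph_of vB; pose GC := graph_of vC.
pose phi (x : gsum (gsum GA GB) GC) : gsum GA (gsum GB GC) :=
  match x with inl (inl a) => inl a | inl (inr b) => inr (inl b) | inr c => inr (inr c) end.
have m1 := models_dsum (models_dsum mA mB) mC.
have m2 := models_dsum mA (models_dsum mB mC).
rewrite !ssumT in m1 m2.
have m3 := models_pull (phi := phi) (U := setT) m2.
apply: (models_iso m1 (m3 _ _ _ _)).
- by move=> [[x|x]|x] [[y|y]|y] _ _ //= [] ->.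
- apply/setP=> -[x|[x|x]]; rewrite inE; apply/imsetP.
  + by exists (inl (inl x)).
  + by exists (inl (inr x)).
  + by exists (inr x).
- by move=> [[x|x]|x].
- by move=> [[x|x]|x] [[y|y]|y] _ _ h.
Qed.

(** Commutativity in the form that carries a factor of an iterated sum past its head, as in
    [picks_iso]. *)
Lemma dsumCA (A B C : rep Q) : valid A -> valid B -> valid C ->
  isob (dsum A (dsum B C)) (dsum B (dsum A C)).
Proof.
move=> vA vB vC; have mA := models_graph_of vA; have mB := models_graph_of vB.
have mC := models_graph_of vC.
pose GA := graph_of vA; pose GB := graph_of vB; pose GC := graph_of vC.
pose phi (x : gsum GA (gsum GB GC)) : gsum GB (gsum GA GC) :=
  match x with inl a => inr (inl a) | inr (inl b) => inl b | inr (inr c) => inr (inr c) end.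
have m1 := models_dsum mA (models_dsum mB mC).
have m2 := models_dsum mB (models_dsum mA mC).
rewrite !ssumT in m1 m2.
have m3 := models_pull (phi := phi) (U := setT) m2.
apply: (models_iso m1 (m3 _ _ _ _)).
- by move=> [x|[x|x]] [y|[y|y]] _ _ //= [] ->.
- apply/setP=> -[x|[x|x]]; rewrite inE; apply/imsetP.
  + by exists (inr (inl x)).
  + by exists (inl x).
  + by exists (inr (inr x)).
- by move=> [x|[x|x]].
- by move=> [x|[x|x]] [y|[y|y]] _ _ h.
Qed.

End DsumIso.

(** * Subrepresentations as sets of points closed under arrows *)

Section SubSum.
Variable Q : quiver.
Local Notation V := (qvert Q).
Local Notation E := (qarrow Q).
Local Notation src := (@qsrc Q).
Local Notation tgt := (@qtgt Q).
Local Notation graph := (graph Q).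

(** Closedness is relative to [U]: in a representation modelled on [U], an arrow leaving [U] means
    that the edge map hits the base point. *)
Definition gclosed (G : graph) (U S : {set G}) := (S \subset U) &&
  [forall h, forall x, forall y, [&& x \in S, y \in U & garr h x y] ==> (y \in S)].

Lemma gclosedP (G : graph) (U S : {set G}) : reflect
  (S \subset U /\ forall h x y, x \in S -> y \in U -> garr h x y -> y \in S) (gclosed U S).
Proof.
apply: (iffP andP) => -[sU H]; split=> //.
  move=> h x y xS yU a; move/forallP/(_ h)/forallP/(_ x)/forallP/(_ y): H.
  by rewrite xS yU a.
apply/forallP=> h; apply/forallP=> x; apply/forallP=> y.
by apply/implyP=> /and3P[xS yU a]; exact: H a.
Qed.

Section Transport.
Variables (M : rep Q) (G : graph) (U : {set G}) (e : G -> nat).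
Hypothesis m : @models Q M G U e.

Definition pts_of (T : subsets_of M) : {set G} := [set x in U | inord (e x) \in T (gvert x)].
Definition of_pts (S : {set G}) : subsets_of M :=
  finfun (fun i => [set k : 'I_(rdim M i).+1 | (k == ord0) ||
    [exists x in S, (gvert x == i) && (e x == k)]]).

Lemma of_pts0 S i : ord0 \in of_pts S i.
Proof. by rewrite ffunE inE eqxx. Qed.

Lemma mem_of_pts (S : {set G}) i x : S \subset U -> x \in U -> gvert x = i ->
  ((inord (e x) : 'I_(rdim M i).+1) \in of_pts S i) = (x \in S).
Proof.
move=> /subsetP SU xU vx; have b := mod_bound m xU.
have l : e x < (rdim M i).+1 by rewrite ltnS -vx; case/andP: b.
rewrite ffunE inE -val_eqE /= inordK //.
have -> : (e x == 0) = false by case/andP: b; case: (e x).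
apply/existsP/idP => [[y /and3P[yS /eqP vy /eqP ey]]|xS]; last by exists x; rewrite xS vx !eqxx.
by rewrite (mod_inj m xU (SU _ yS)) // vx vy.
Qed.

Lemma of_ptsP (S : {set G}) i (k : 'I_(rdim M i).+1) : k \in of_pts S i ->
  k = ord0 \/ exists x, [/\ x \in S, gvert x = i & e x = k].
Proof.
rewrite ffunE inE => /orP[/eqP->|/existsP[x /and3P[xS /eqP vx /eqP ex]]]; first by left.
by right; exists x.
Qed.

Lemma pts_ofK T : is_subrep T -> of_pts (pts_of T) = T.
Proof.
move=> /andP[/forallP T0 _]; apply/ffunP => i; apply/setP => k.
apply/idP/idP => [/of_ptsP[->|[x []]]|kT]; first exact: T0.
  rewrite inE => /andP[xU xT] vx ex; move: xT.
  by case: _ / vx k ex => k ->; rewrite inord_val.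
rewrite ffunE inE; case: (eqVneq k ord0) => //= k0.
have [|x [xU vx ex]] := mod_surj m (i := i) (n := k).
  by rewrite -[k <= _]ltnS ltn_ord andbT lt0n; rewrite -val_eqE in k0.
apply/existsP; exists x; rewrite vx ex !eqxx inE xU ex !andbT /=.
by case: _ / vx k kT {k0 ex} => k kT; rewrite inord_val.
Qed.

Lemma of_ptsK (S : {set G}) : S \subset U -> pts_of (of_pts S) = S.
Proof.
move=> SU; apply/setP => x; rewrite inE; apply/andP/idP => [[xU]|xS].
  by rewrite mem_of_pts.
have xU := subsetP SU _ xS.
by rewrite mem_of_pts.
Qed.

Lemma is_subrep_of_pts (S : {set G}) : S \subset U -> is_subrep (of_pts S) = gclosed U S.
Proof.
move=> SU; apply/andP/gclosedP => [[_ H]|[_ H]].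
  split=> // h x y xS yU a; have xU := subsetP SU _ xS.
  have vx := garr_src a; have vy := garr_tgt a.
  move/forallP/(_ h)/forallP/(_ (inord (e x))): H; rewrite (mem_of_pts SU xU vx) xS /=.
  move: a; rewrite (mod_arr m) // => /eqP a.
  by rewrite -[rmap _]inord_val -/(rmapn M h (e x)) a (mem_of_pts SU yU vy).
split; first by apply/forallP=> i; exact: of_pts0.
apply/forallP=> h; apply/forallP=> k; apply/implyP=> /of_ptsP[->|[x [xS vx ex]]].
  by rewrite (mod_base m) of_pts0.
have xU := subsetP SU _ xS.
case: (eqVneq (rmap k) ord0) => [->|k0]; first exact: of_pts0.
have [|y [yU vy ey]] := mod_surj m (i := tgt h) (n := rmap k).
  by rewrite -[_ <= rdim _ _]ltnS ltn_ord andbT lt0n; rewrite -val_eqE in k0.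
rewrite -[rmap k]inord_val -ey (mem_of_pts SU yU vy).
by apply: (H h x) => //; rewrite (mod_arr m) // ey ex /rmapn inord_val.
Qed.

Lemma models_sub S : gclosed U S -> exists e', @models Q (sub (of_pts S)) G S e'.
Proof.
move=> /gclosedP[SU _]; rewrite -{2}(of_ptsK SU); eexists.
apply: models_restr m; exact: of_pts0.
Qed.

Lemma models_quo S : gclosed U S -> exists e', @models Q (quo (of_pts S)) G (U :\: S) e'.
Proof.
move=> /gclosedP[SU _].
have -> : U :\: S = [set x in U | inord (e x) \in ~: of_pts S (gvert x) :|: [set ord0]].
  apply/setP=> x; rewrite !inE andbC; case: (boolP (x \in U)) => //= xU.
  have e0 : (inord (e x) == ord0 :> 'I_(rdim M (gvert x)).+1) = false.
    have := mod_bound m xU => /andP[x0 xle].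
    by rewrite -val_eqE /= inordK ?ltnS // -(prednK x0).
  by rewrite (mem_of_pts SU xU erefl) e0 orbF.
by eexists; apply: models_restr m => i; rewrite !inE eqxx orbT.
Qed.
End Transport.

Implicit Types M N : rep Q.

Lemma models_subrep M G U e (m : @models Q M G U e) (T : subsets_of M) : is_subrep T ->
  exists S e1 e2, [/\ gclosed U S, @models Q (sub T) G S e1 & @models Q (quo T) G (U :\: S) e2].
Proof.
move=> T1; exists (pts_of U e T); have SU : pts_of U e T \subset U.
  by apply/subsetP=> x; rewrite inE => /andP[].
have cl : gclosed U (pts_of U e T) by rewrite -(is_subrep_of_pts m SU) (pts_ofK m T1).
have [e1] := models_sub m cl; have [e2] := models_quo m cl.
by rewrite (pts_ofK m T1) => m2 m1; exists e1, e2.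
Qed.

Lemma sub_valid M (T : subsets_of M) : valid M -> is_subrep T -> valid (sub T).
Proof.
by move=> vM /(models_subrep (models_graph_of vM))[S [e1 [e2 [_ m1 _]]]]; exact: models_valid m1.
Qed.

Lemma quo_valid M (T : subsets_of M) : valid M -> is_subrep T -> valid (quo T).
Proof.
by move=> vM /(models_subrep (models_graph_of vM))[S [e1 [e2 [_ _ m1]]]]; exact: models_valid m1.
Qed.

Lemma subquo_dim M (T : subsets_of M) i : valid M -> is_subrep T ->
  rdim M i = rdim (sub T) i + rdim (quo T) i.
Proof.
move=> vM /(models_subrep (models_graph_of vM))[S [e1 [e2 [/gclosedP[SU _] m1 m2]]]].
rewrite (models_dim (models_graph_of vM)) (models_dim m1) (models_dim m2).
rewrite -(cardsID S) /fib; congr (_ + _).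
  by apply: eq_card => x; rewrite !inE andbC.
by apply: eq_card => x; rewrite !inE andbT.
Qed.

Definition inv1 (T : Type) (f : rep Q -> T) := forall M N, valid M -> valid N -> isob M N -> f M = f N.
Definition inv2 (T : Type) (f : rep Q -> rep Q -> T) := forall M M' N N',
  valid M -> valid M' -> valid N -> valid N' -> isob M M' -> isob N N' -> f M N = f M' N'.

Lemma inv1_models (T : Type) (f : rep Q -> T) M G U e : inv1 f -> @models Q M G U e -> f M = f (real U).
Proof.
move=> If m; apply: If; [exact: models_valid m | exact: real_valid | ].
exact: models_iso m (models_real U).
Qed.

Lemma inv2_models (T : Type) (f : rep Q -> rep Q -> T) M G U e N G' U' e' : inv2 f ->
  @models Q M G U e -> @models Q N G' U' e' -> f M N = f (real U) (real U').
Proof.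
move=> If m m'; apply: If; [exact: models_valid m | exact: real_valid
  | exact: models_valid m' | exact: real_valid | | ].
  exact: models_iso m (models_real U).
exact: models_iso m' (models_real U').
Qed.

(** The index type [subsets_of M] depends on [M]. Sets of points of [G] do not, so sums for
    isomorphic representations or for nested subobjects can be compared term by term. *)
Lemma sum_subrep (R : nmodType) (F : rep Q -> rep Q -> R) M G U e :
  inv2 F -> @models Q M G U e ->
  (\sum_(T : subsets_of M | is_subrep T) F (quo T) (sub T) =
   \sum_(S : {set G} | gclosed U S) F (real (U :\: S)) (real S))%R.
Proof.
move=> IF m.
rewrite (reindex_onto (of_pts M e) (pts_of U e)) /=; last by move=> T; exact: (pts_ofK m).
apply: eq_big => [S|S /andP[sr /eqP eS]].
  apply/andP/idP => [[sr /eqP eS]|cl].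
    rewrite -(is_subrep_of_pts m) // -eS; apply/subsetP=> x; rewrite inE => /andP[] //.
  have /gclosedP[SU _] := cl.
  by rewrite (is_subrep_of_pts m SU) (of_ptsK m SU) eqxx.
have cl : gclosed U S.
  rewrite -(is_subrep_of_pts m) // -eS; apply/subsetP=> x; rewrite inE => /andP[] //.
have [e1 m1] := models_sub m cl; have [e2 m2] := models_quo m cl.
exact: inv2_models IF m2 m1.
Qed.

(** * The Hall product: unit, associativity, direct sums *)

Section HallProduct.
Variable K : fieldType.
Local Open Scope ring_scope.
Implicit Types f g : rep Q -> K.

Lemma inv2_mul f g : inv1 f -> inv1 g -> inv2 (fun M N => f M * g N).
Proof. by move=> If Ig M M' N N' vM vM' vN vN' iM iN; rewrite (If M M') // (Ig N N'). Qed.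

Lemma hmul_models f g M G U e : inv1 f -> inv1 g -> @models Q M G U e ->
  hmul f g M = \sum_(S : {set G} | gclosed U S) f (real (U :\: S)) * g (real S).
Proof.
move=> If Ig m; rewrite /hmul (models_valid m).
exact: (sum_subrep (F := fun M N => f M * g N) (inv2_mul If Ig) m).
Qed.

Lemma hmul_inv f g : inv1 f -> inv1 g -> inv1 (hmul f g).
Proof.
move=> If Ig M N vM vN i; have m := models_graph_of vM.
have [e m'] := models_isob m i.
by rewrite (hmul_models If Ig m) (hmul_models If Ig m').
Qed.

Lemma hone_inv : inv1 (hone K : rep Q -> K).
Proof. by move=> M N vM vN i; rewrite /hone vM vN (isob_zero i). Qed.

Lemma hone_models M G U e : @models Q M G U e -> hone K M = (U == set0)%:R.
Proof. by move=> m; rewrite /hone (models_valid m) (models_zero m). Qed.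

Lemma gclosed0 (G : graph) (U : {set G}) : gclosed U set0.
Proof. by apply/gclosedP; split; [exact: sub0set | move=> h x y; rewrite inE]. Qed.

Lemma gclosedT (G : graph) (U : {set G}) : gclosed U U.
Proof. by apply/gclosedP; split. Qed.

Lemma hmul1r g M : inv1 g -> valid M -> hmul (hone K) g M = g M.
Proof.
move=> Ig vM; have m := models_graph_of vM.
rewrite (hmul_models hone_inv Ig m) (bigD1 setT) ?gclosedT //= big1 => [|S /andP[cl ST]].
  by rewrite (hone_models (models_real _)) setDv eqxx mul1r addr0 -(inv1_models Ig m).
rewrite (hone_models (models_real _)) setD_eq0 subTset (negbTE ST) mul0r //.
Qed.

Lemma hmulr1 g M : inv1 g -> valid M -> hmul g (hone K) M = g M.
Proof.
move=> Ig vM; have m := models_graph_of vM.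
rewrite (hmul_models Ig hone_inv m) (bigD1 set0) ?gclosed0 //= big1 => [|S /andP[cl ST]].
  by rewrite (hone_models (models_real _)) setD0 eqxx mulr1 addr0 -(inv1_models Ig m).
rewrite (hone_models (models_real _)) (negbTE ST) mulr0 //.
Qed.

(** Both sides sum over chains of closed sets [T] in [S] in [U], with [f] on [U :\: S], [g] on
    [S :\: T] and [h] on [T]: closed sets of the quotient by [T] are the closed sets containing [T],
    with [T] removed. *)
Lemma hmulA f g h : inv1 f -> inv1 g -> inv1 h ->
  hmul (hmul f g) h = hmul f (hmul g h).
Proof.
move=> If Ig Ih; apply: functional_extensionality => M.
case: (boolP (valid M)) => [vM|nv]; last by rewrite /hmul (negbTE nv).
have m := models_graph_of vM; set U := [set: _] in m.
rewrite (hmul_models (hmul_inv If Ig) Ih m) (hmul_models If (hmul_inv Ig Ih) m).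
under eq_bigr => S _ do rewrite (hmul_models If Ig (models_real _)) big_distrl /=.
under [RHS]eq_bigr => S _ do rewrite (hmul_models Ig Ih (models_real _)) big_distrr /=.
rewrite !pair_big_dep /=.
rewrite (reindex_onto (fun p => (p.2, p.1 :\: p.2)) (fun p => (p.1 :|: p.2, p.1))) /=; last first.
  move=> [S T] /= /andP[/gclosedP[SU _] /gclosedP[TU _]]; congr (_, _).
  apply/setP=> x; rewrite !inE; case: (boolP (x \in S)) => //= xS.
  by apply/esym; apply: contraTF xS => /(subsetP TU); rewrite inE => /andP[].
apply: eq_big => [[S T] /=|[S T] /= /andP[/andP[cT cS] /eqP[eS]]].
  apply/andP/andP => [[/andP[/gclosedP[TU aT] /gclosedP[SU aS]] /eqP[eS]]|[/gclosedP[SU aS] /gclosedP[TS aT]]].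
    have TS : T \subset S by rewrite -eS subsetUl.
    split; apply/gclosedP; split.
    - apply/subsetP=> x xS; case: (boolP (x \in T)) => xT; first exact: (subsetP TU).
      by have := subsetP SU x; rewrite !inE xS xT => /(_ isT).
    - move=> k x y xS yU a; case: (boolP (y \in T)) => yT; first exact: (subsetP TS).
      case: (boolP (x \in T)) => xT; first by rewrite (aT k x y) in yT.
      by have := aS k x y; rewrite !inE xS xT yT => /(_ isT isT a).
    - exact: TS.
    - by move=> k x y xT yS; apply: aT.
  split; last first.
    by rewrite eqE /= eqxx andbT; apply/eqP/setP=> x; rewrite !inE; case: (boolP (x \in T)) => // /(subsetP TS)->.
  apply/andP; split; apply/gclosedP; split.
  - exact: subset_trans TS SU.
  - move=> k x y xT yU a; apply: (aT k x) => //; apply: (aS k x) => //; exact: (subsetP TS).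
  - exact: setSD.
  - move=> k x y; rewrite !inE => /andP[xT xS] /andP[yT yU] a; rewrite yT /=; exact: (aS k x).
rewrite mulrA; congr (f (real _) * _ * _).
by rewrite setDDl eS.
Qed.

Lemma gclosed_ssum (GA GB : graph) (UA SA : {set GA}) (UB SB : {set GB}) :
  gclosed (ssum UA UB) (ssum SA SB) = gclosed UA SA && gclosed UB SB.
Proof.
apply/gclosedP/andP => [[sU H]|[/gclosedP[sA HA] /gclosedP[sB HB]]].
  split; apply/gclosedP; split.
  - by apply/subsetP=> x xA; have := subsetP sU (inl x); rewrite !inE; apply.
  - by move=> h x y xS yU a; have := H h (inl x) (inl y); rewrite !inE; apply.
  - by apply/subsetP=> x xA; have := subsetP sU (inr x); rewrite !inE; apply.
  - by move=> h x y xS yU a; have := H h (inr x) (inr y); rewrite !inE; apply.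
split; first by apply/subsetP=> -[x|x]; rewrite !inE; [exact: (subsetP sA)|exact: (subsetP sB)].
by move=> h [x|x] [y|y]; rewrite !inE //=; [exact: HA|exact: HB].
Qed.

(** Here the geometry over F_1 enters: a subset of a disjoint union splits, and no arrow joins the
    two parts, so a subobject of a sum is a sum of subobjects. Over a field, diagonals would break
    this. *)
Lemma sum_subrep_dsum (R : nmodType) (F : rep Q -> rep Q -> R) A B :
  inv2 F -> valid A -> valid B ->
  \sum_(T : subsets_of (dsum A B) | is_subrep T) F (quo T) (sub T) =
  \sum_(S : subsets_of A | is_subrep S) \sum_(T : subsets_of B | is_subrep T)
    F (dsum (quo S) (quo T)) (dsum (sub S) (sub T)).
Proof.
move=> IF vA vB; have mA := models_graph_of vA; have mB := models_graph_of vB.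
have mS := models_dsum mA mB.
rewrite (sum_subrep IF mS).
have IB A1 A2 : valid A1 -> valid A2 -> inv2 (fun X Y => F (dsum A1 X) (dsum A2 Y)).
  move=> v1 v2 X X' Y Y' vX vX' vY vY' iX iY; apply: IF; rewrite ?dsum_valid //.
    by apply: dsum_iso => //; exact: isob_refl.
  by apply: dsum_iso => //; exact: isob_refl.
transitivity (\sum_(S : subsets_of A | is_subrep S) \sum_(T | gclosed (setT : {set graph_of vB}) T)
   F (dsum (quo S) (real (setT :\: T))) (dsum (sub S) (real T))); last first.
  apply: eq_bigr => S sS; rewrite (sum_subrep (IB _ _ _ _) mB) //.
    exact: quo_valid.
  exact: sub_valid.
rewrite (sum_subrep (F := fun X Y => \sum_(T | gclosed (setT : {set graph_of vB}) T)
   F (dsum X (real (setT :\: T))) (dsum Y (real T))) _ mA); last first.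
  move=> X X' Y Y' vX vX' vY vY' iX iY; apply: eq_bigr => T _.
  apply: IF; rewrite ?dsum_valid ?real_valid //.
    by apply: dsum_iso; rewrite ?isob_refl ?real_valid.
  by apply: dsum_iso; rewrite ?isob_refl ?real_valid.
rewrite pair_big /=.
pose h (p : {set graph_of vA} * {set graph_of vB}) := ssum p.1 p.2.
pose h' (S : {set gsum (graph_of vA) (graph_of vB)}) :=
   ([set x | inl x \in S], [set x | inr x \in S]).
have hK : cancel h h'.
  by move=> [X Y]; congr (_, _); apply/setP=> x; rewrite !inE.
have h'K : cancel h' h by move=> S; apply/setP=> -[x|x]; rewrite !inE.
rewrite (reindex h) /=; last by apply: onW_bij; exists h'.
apply: eq_big => [[X Y]|[X Y] _] /=; first exact: gclosed_ssum.
have eD : ssum setT setT :\: h (X, Y) =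
    ssum ((setT : {set graph_of vA}) :\: X) ((setT : {set graph_of vB}) :\: Y).
  by apply/setP=> -[x|x]; rewrite !inE.
rewrite eD.
by apply/esym/(inv2_models IF); apply: models_dsum (models_real _) (models_real _).
Qed.

Lemma hmul_dsum f g A B : inv1 f -> inv1 g -> valid A -> valid B ->
  hmul f g (dsum A B) =
  \sum_(S : subsets_of A | is_subrep S) \sum_(T : subsets_of B | is_subrep T)
    f (dsum (quo S) (quo T)) * g (dsum (sub S) (sub T)).
Proof.
move=> If Ig vA vB; rewrite /hmul dsum_valid //.
exact: (sum_subrep_dsum (F := fun M N => f M * g N) (inv2_mul If Ig)).
Qed.

Lemma rep0_valid : valid (rep0 Q).
Proof.
by apply: validP => [h|h x y _ _]; apply: val_inj => //=; rewrite [x]ord1 [y]ord1.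
Qed.

Lemma rep0_zero : isZero (rep0 Q).
Proof. exact/isZeroP. Qed.

Lemma zero_iso0 (M : rep Q) : valid M -> isZero M -> isob (rep0 Q) M.
Proof.
move=> vM M0; have m0 := models_graph_of rep0_valid; have m := models_graph_of vM.
have m' := models_pull (G := graph_of rep0_valid) (U := setT) (phi := fun x => match zero_pt x rep0_zero with end) m.
apply: (models_iso m0 (m' _ _ _ _)) => [x||x|x].
- by case: (zero_pt x rep0_zero).
- by apply/setP=> x; case: (zero_pt x M0).
- by case: (zero_pt x rep0_zero).
- by case: (zero_pt x rep0_zero).
Qed.

Lemma hmul_rep0 f g : inv1 f -> inv1 g -> hmul f g (rep0 Q) = f (rep0 Q) * g (rep0 Q).
Proof.
move=> If Ig; have m := models_graph_of rep0_valid.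
have noset (S : {set graph_of rep0_valid}) : S = setT.
  by apply/setP=> x; case: (zero_pt x rep0_zero).
rewrite (hmul_models If Ig m) (bigD1 setT) ?gclosedT //= big1 ?addr0; last first.
  by move=> S /andP[_]; rewrite (noset S) eqxx.
rewrite (noset (_ :\: _)); congr (_ * _).
  by rewrite -(inv1_models If m).
by rewrite -(inv1_models Ig m).
Qed.
End HallProduct.
End SubSum.

(** * Finiteness and nilpotency *)

Section FinNil.
Variable Q : quiver.
Local Notation V := (qvert Q).
Local Notation E := (qarrow Q).
Local Notation src := (@qsrc Q).
Local Notation tgt := (@qtgt Q).
Local Notation graph := (graph Q).
Implicit Types M N A B : rep Q.

(** Agreement of dimensions and of maps on numbers stands in for equality of dependent records. *)
Lemma models_eq M N (G : graph) (U : {set G}) e : models M U e ->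
  (forall i, rdim N i = rdim M i) ->
  (forall h n, n <= rdim M (src h) -> rmapn N h n = rmapn M h n) -> models N U e.
Proof.
move=> m dE rE; split.
- by move=> h; apply: val_inj; rewrite /= -(rmapn0 h (mod_base m)) -rE // /rmapn inord0.
- by move=> x xU; rewrite dE (mod_bound m).
- exact: (mod_inj m).
- by move=> i n; rewrite dE; exact: (mod_surj m).
- move=> h x y xU yU vx vy; rewrite (mod_arr m) // rE // -vx.
  by case/andP: (mod_bound m xU).
Qed.

(** Up to isomorphism such a representation is a table of numbers at most [D]. Finite support modulo
    isomorphism can therefore be replaced by bounded dimension, which is easy to follow through
    products. *)
Lemma bounded_fin D : exists k (g : 'I_k -> rep Q),
  forall M, valid M -> (forall i, rdim M i <= D) -> exists j, isob M (g j).
Proof.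
pose T : finType := ({ffun V -> 'I_D.+1} * {ffun E -> {ffun 'I_D.+1 -> 'I_D.+1}})%type.
pose r (t : T) : rep Q := @Rep Q (fun i => t.1 i) (fun h x => inord (t.2 h (inord x))).
exists #|T|, (fun j => r (enum_val j)) => M vM dM.
pose t : T := ([ffun i => inord (rdim M i)], [ffun h => [ffun x : 'I_D.+1 => inord (rmapn M h x)]]).
exists (enum_rank t); rewrite enum_rankK.
have m := models_graph_of vM; apply: models_iso m (models_eq m _ _).
  by move=> i /=; rewrite ffunE inordK // ltnS dM.
move=> h n nle; have lD := leq_trans nle (dM _).
rewrite {1}/rmapn /= !ffunE inordK; last by rewrite inordK ?inordK // ltnS ?rmapn_le // (leq_trans (rmapn_le _ _ _)).
have -> : (inord n : 'I_(inord (rdim M (src h)) : 'I_D.+1).+1) = n :> nat.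
  by rewrite inordK // inordK // ltnS.
by rewrite !inordK // ltnS (leq_trans (rmapn_le _ _ _)).
Qed.

Definition tdim M := \sum_i rdim M i.

Lemma tdim_dsum A B : tdim (dsum A B) = tdim A + tdim B.
Proof. by rewrite /tdim -big_split. Qed.

Lemma tdim_iso M N : isob M N -> tdim M = tdim N.
Proof. by move=> i; apply: eq_bigr => j _; exact: isob_dim. Qed.

Lemma tdim_zero M : isZero M = (tdim M == 0).
Proof.
rewrite /tdim sum_nat_eq0; apply/isZeroP/forallP => H i; last by apply/eqP/(implyP (H i)).
by rewrite H eqxx.
Qed.

Fixpoint gpath (G : graph) (U : {set G}) k (x : G) : Prop :=
  if k is k'.+1 then exists h y, [/\ y \in U, garr h x y & gpath U k' y] else True.

Lemma nz_after0 M k i : basepreserving M -> ~ nz_after M k i 0.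
Proof.
move=> b; elim: k i => [|k IH] i /=; first exact.
by move=> [h [_]]; rewrite -/(rmapn M h 0) rmapn0 //; exact: IH.
Qed.

Lemma models_path M G U e : @models Q M G U e -> forall k x, x \in U ->
  nz_after M k (gvert x) (e x) <-> gpath U k x.
Proof.
move=> m; elim=> [|k IH] x xU /=.
  by split=> // _ e0; have := mod_bound m xU; rewrite e0.
split=> [[h [vx]]|[h [y [yU a p]]]]; last first.
  exists h; rewrite (garr_src a); split=> //; rewrite -/(rmapn M h (e x)) -(garr_tgt a).
  have := a; rewrite (mod_arr m) //; [move/eqP=> -> | exact: garr_src a | exact: garr_tgt a].
  by apply/IH.
rewrite -/(rmapn M h (e x)).
have [->|z] := posnP (rmapn M h (e x)); first by move/nz_after0; case; exact: mod_base m.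
have [|y [yU vy ey]] := mod_surj m (i := tgt h) (n := rmapn M h (e x)).
  by rewrite z rmapn_le.
rewrite -ey -vy => /(IH _ yU) p; exists h, y; split=> //.
by rewrite (mod_arr m) // ey.
Qed.

Lemma models_nilp M G U e : @models Q M G U e ->
  nilpotent M <-> exists n, forall k, n <= k -> forall x, x \in U -> ~ gpath U k x.
Proof.
move=> m; split=> -[N H]; exists N => k Nk.
  move=> x xU /(models_path m _ xU).
  have l : e x < (rdim M (gvert x)).+1 by rewrite ltnS; case/andP: (mod_bound m xU).
  by have := H k Nk (gvert x) (Ordinal l).
move=> i x; have [x0|x0] := posnP x; first by rewrite x0; apply: nz_after0; exact: mod_base m.
have [|y [yU vy ey]] := mod_surj m (i := i) (n := x); first by rewrite x0 -ltnS /=.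
by rewrite -ey -vy => /(models_path m _ yU); exact: H.
Qed.

Lemma gpath_le (G : graph) (U : {set G}) k l x : k <= l -> gpath U l x -> gpath U k x.
Proof.
elim: k l x => [|k IH] [|l] x //= kl [h [y [yU a p]]].
by exists h, y; split=> //; exact: IH p.
Qed.

Lemma gpath_closed (G : graph) (U S : {set G}) k x : gclosed U S -> x \in S -> gpath U k x -> gpath S k x.
Proof.
move=> /gclosedP[SU H]; elim: k x => //= k IH x xS [h [y [yU a p]]].
have yS := H _ _ _ xS yU a.
by exists h, y; split=> //; exact: IH.
Qed.

(** A path that enters [S] cannot leave it within [U]; either this happens early enough to leave [b]
    steps in [S], or the first [a] steps avoid [S]. *)
Lemma gpath_ext (G : graph) (U S : {set G}) a b x : gclosed U S -> gpath U (a + b) x ->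
  gpath (U :\: S) a x \/ exists y, y \in S /\ gpath S b y.
Proof.
move=> cl; elim: a x => [|a IH] x /=; first by left.
move=> [h [y [yU ar p]]]; case: (boolP (y \in S)) => yS.
  right; exists y; split=> //; apply: (gpath_le (leq_addl a b)).
  exact: gpath_closed p.
have [q|] := IH y p; last by right.
by left; exists h, y; rewrite inE yS.
Qed.

Lemma nilp_iso M N : valid M -> isob M N -> nilpotent M -> nilpotent N.
Proof.
move=> vM i; have m := models_graph_of vM; have [e m'] := models_isob m i.
by move/(models_nilp m) => H; apply/(models_nilp m').
Qed.

Lemma nilp_zero M : valid M -> isZero M -> nilpotent M.
Proof.
move=> vM M0; apply/(models_nilp (models_graph_of vM)).
by exists 0 => k _ x; case: (zero_pt x M0).
Qed.

Lemma gpath_suml (GA GB : graph) (UA : {set GA}) (UB : {set GB}) k x :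
  gpath UA k x -> gpath (ssum UA UB) k (inl x).
Proof.
elim: k x => //= k IH x [h [y [yS a p]]].
by exists h, (inl y); split; rewrite ?inE //; exact: IH.
Qed.

Lemma gpath_sumr (GA GB : graph) (UA : {set GA}) (UB : {set GB}) k x :
  gpath UB k x -> gpath (ssum UA UB) k (inr x).
Proof.
elim: k x => //= k IH x [h [y [yS a p]]].
by exists h, (inr y); split; rewrite ?inE //; exact: IH.
Qed.

Lemma nilp_dsum A B : valid A -> valid B -> nilpotent (dsum A B) -> nilpotent A /\ nilpotent B.
Proof.
move=> vA vB; have mA := models_graph_of vA; have mB := models_graph_of vB.
move/(models_nilp (models_dsum mA mB)) => [N H].
split; [apply/(models_nilp mA) | apply/(models_nilp mB)]; exists N => k Nk x xU p.
  by apply: (H k Nk (inl x)); rewrite ?inE //; exact: gpath_suml.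
by apply: (H k Nk (inr x)); rewrite ?inE //; exact: gpath_sumr.
Qed.

Lemma nilp_ext M (T : subsets_of M) : valid M -> is_subrep T ->
  nilpotent (quo T) -> nilpotent (sub T) -> nilpotent M.
Proof.
move=> vM sT; have m := models_graph_of vM.
have [S [e1 [e2 [cl m1 m2]]]] := models_subrep m sT.
move/(models_nilp m2) => [N2 H2] /(models_nilp m1) [N1 H1].
apply/(models_nilp m); exists (N2.+1 + N1) => k kN x xU p.
have {p} := gpath_le kN p; rewrite addSn => -[h [y [yU a p]]].
have [yS|yS] := boolP (y \in S).
  apply: (H1 N1 _ y) => //; apply: (gpath_le (leq_addl N2 N1)); exact: gpath_closed p.
have [q|[z [zS q]]] := gpath_ext cl p.
  by apply: (H2 N2 _ y) => //; rewrite inE yS.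
exact: (H1 N1 _ z).
Qed.
End FinNil.
Local Open Scope ring_scope.

(** * The filtration by the number of summands *)

Section HallAlgebra.
Variables (Q : quiver) (K : fieldType).
Implicit Types (M N A B : rep Q) (f g x y : rep Q -> K) (Ns Us ws : seq (rep Q)).

Definition hzero : rep Q -> K := fun _ => 0.

Section Bilinear.
Lemma hmulDl f g h : hmul (hadd f g) h = hadd (hmul f h) (hmul g h).
Proof.
apply: functional_extensionality => M; rewrite /hadd /hmul; case: ifP => _; last by rewrite addr0.
by rewrite -big_split; apply: eq_bigr => S _; rewrite mulrDl.
Qed.

Lemma hmulDr f g h : hmul f (hadd g h) = hadd (hmul f g) (hmul f h).
Proof.
apply: functional_extensionality => M; rewrite /hadd /hmul; case: ifP => _; last by rewrite addr0.
by rewrite -big_split; apply: eq_bigr => S _; rewrite mulrDr.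
Qed.

Lemma hmulZl c f g : hmul (hscale c f) g = hscale c (hmul f g).
Proof.
apply: functional_extensionality => M; rewrite /hscale /hmul; case: ifP => _; last by rewrite mulr0.
by rewrite big_distrr; apply: eq_bigr => S _ /=; rewrite mulrA.
Qed.

Lemma hmulZr c f g : hmul f (hscale c g) = hscale c (hmul f g).
Proof.
apply: functional_extensionality => M; rewrite /hscale /hmul; case: ifP => _; last by rewrite mulr0.
by rewrite big_distrr; apply: eq_bigr => S _ /=; rewrite mulrCA.
Qed.

Lemma hmul0l g : hmul hzero g = hzero.
Proof.
apply: functional_extensionality => M; rewrite /hmul; case: ifP => // _.
by rewrite big1 // => S _; rewrite mul0r.
Qed.

Lemma hmul0r g : hmul g hzero = hzero.
Proof.
apply: functional_extensionality => M; rewrite /hmul; case: ifP => // _.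
by rewrite big1 // => S _; rewrite mulr0.
Qed.
End Bilinear.

Lemma hmul_nonvalid f g M : ~~ valid M -> hmul f g M = 0.
Proof. by rewrite /hmul => /negbTE->. Qed.

Lemma inv1_add f g : inv1 f -> inv1 g -> inv1 (hadd f g).
Proof. by move=> If Ig M N vM vN i; rewrite /hadd (If M N) // (Ig M N). Qed.

Lemma inv1_scale c f : inv1 f -> inv1 (hscale c f).
Proof. by move=> If M N vM vN i; rewrite /hscale (If M N). Qed.

Lemma delta_inv N : inv1 (delta K N).
Proof.
move=> M M' vM vM' i; rewrite /delta vM vM' /=; congr (nat_of_bool _)%:R.
apply/idP/idP => j; last exact: isob_trans vM i j.
exact: isob_trans vM' (isob_sym vM i) j.
Qed.

Lemma delta_eq N N' : valid N -> valid N' -> isob N N' -> delta K N = delta K N'.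
Proof.
move=> vN vN' i; apply: functional_extensionality => M; rewrite /delta.
case: (boolP (valid M)) => //= vM; congr (nat_of_bool _)%:R.
apply/idP/idP => j; first exact: isob_trans vM j i.
exact: isob_trans vM j (isob_sym vN i).
Qed.

Lemma inv1_dsuml (T : Type) (g : rep Q -> T) A : inv1 g -> valid A -> inv1 (fun X => g (dsum A X)).
Proof.
move=> Ig vA M N vM vN i; apply: Ig; rewrite ?dsum_valid //.
by apply: dsum_iso => //; exact: isob_refl.
Qed.

Lemma inv1_dsumr (T : Type) (g : rep Q -> T) A : inv1 g -> valid A -> inv1 (fun X => g (dsum X A)).
Proof.
move=> Ig vA M N vM vN i; apply: Ig; rewrite ?dsum_valid //.
by apply: dsum_iso => //; exact: isob_refl.
Qed.

Lemma primE x A B : primitive x -> valid A -> valid B ->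
  x (dsum A B) = x A * hone K B + hone K A * x B.
Proof. by move=> px vA vB; have := px A B vA vB; rewrite /coprod vA vB. Qed.

(** At the sum of two zero representations, again zero, primitivity says that the value equals its
    double. *)
Lemma prim_rep0 x : inv1 x -> primitive x -> x (rep0 Q) = 0.
Proof.
move=> Ix px; have v0 := rep0_valid Q; have z0 := rep0_zero Q.
have := primE px v0 v0; rewrite (Ix _ (rep0 Q)) ?dsum_valid //; last exact: dsum_zerol.
rewrite /hone v0 z0 mulr1 mul1r => /eqP.
by rewrite -subr_eq0 opprD addrA subrr add0r oppr_eq0 => /eqP.
Qed.

(** Primitivity splits [x] on a sum of quotients into a term forcing the quotient of [B] to be zero
    and one forcing that of [A] to be zero. Summing over the subobjects of that factor is then the
    unit law [hmul1r]. *)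
Lemma hmul_prim_dsum x g A B : inv1 x -> inv1 g -> primitive x -> valid A -> valid B ->
  hmul x g (dsum A B) = hmul x (fun X => g (dsum X B)) A + hmul x (fun Y => g (dsum A Y)) B.
Proof.
move=> Ix Ig px vA vB; rewrite hmul_dsum //.
pose t1 (S : subsets_of A) (T : subsets_of B) :=
  x (quo S) * (hone K (quo T) * g (dsum (sub S) (sub T))).
pose t2 (S : subsets_of A) (T : subsets_of B) :=
  x (quo T) * (hone K (quo S) * g (dsum (sub S) (sub T))).
rewrite (eq_bigr (fun S => \sum_(T | is_subrep T) t1 S T + \sum_(T | is_subrep T) t2 S T)); last first.
  move=> S sS; rewrite -big_split; apply: eq_bigr => T sT /=.
  rewrite primE ?quo_valid // /t1 /t2; ring.
rewrite big_split /=; congr (_ + _); last rewrite exchange_big /=.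
  rewrite /hmul vA; apply: eq_bigr => S sS; rewrite /t1 -big_distrr /=; congr (_ * _).
  have := @hmul1r Q K (fun Y => g (dsum (sub S) Y)) B; rewrite /hmul vB; apply => //.
  by apply: inv1_dsuml => //; exact: sub_valid.
rewrite /hmul vB; apply: eq_bigr => S sS; rewrite /t2 -big_distrr /=; congr (_ * _).
have := @hmul1r Q K (fun Y => g (dsum Y (sub S))) A; rewrite /hmul vA; apply => //.
by apply: inv1_dsumr => //; exact: sub_valid.
Qed.

Lemma primitive_bracket x y : inv1 x -> inv1 y -> primitive x -> primitive y -> primitive (hbr x y).
Proof.
move=> Ix Iy px py A B vA vB; rewrite /coprod vA vB /hbr !hmul_prim_dsum //.
(* The mixed terms [u A * v B] and [v A * u B] are exchanged by swapping [u] and [v], so they cancel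
   in the bracket. *)
have step u v (Iu : inv1 u) (Iv : inv1 v) (pv : primitive v) :
   hmul u (fun X => v (dsum X B)) A + hmul u (fun Y => v (dsum A Y)) B =
   hmul u v A * hone K B + u A * v B + (v A * u B + hone K A * hmul u v B).
  congr (_ + _).
    rewrite -[u A in RHS](@hmulr1 Q K u A) // /hmul vA !big_distrl -big_split /=; apply: eq_bigr => S sS.
    by rewrite primE ?sub_valid //; ring.
  rewrite -[u B in RHS](@hmulr1 Q K u B) // /hmul vB !big_distrr -big_split /=; apply: eq_bigr => S sS.
  by rewrite primE ?sub_valid //; ring.
rewrite !step //; ring.
Qed.

Lemma primitive_add x y : primitive x -> primitive y -> primitive (hadd x y).
Proof.
move=> px py A B vA vB; rewrite /coprod vA vB /hadd !primE //; ring.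
Qed.

Lemma primitive_scale c x : primitive x -> primitive (hscale c x).
Proof.
move=> px A B vA vB; rewrite /coprod vA vB /hscale !primE //; ring.
Qed.

Lemma primitive0 : primitive hzero.
Proof. by move=> A B vA vB; rewrite /coprod vA vB /hzero mul0r mulr0 addr0. Qed.

Lemma delta_prim N : valid N -> indecomposable N -> primitive (delta K N).
Proof.
move=> vN [nz ind] A B vA vB; rewrite /coprod vA vB /hone vA vB /delta dsum_valid // vA vB /=.
have [zA|nA] := boolP (isZero A).
  have -> : isob A N = false.
    by apply: contraNF nz => i; rewrite -(isob_zero i).
  rewrite mul0r mul1r add0r; congr (nat_of_bool _)%:R.
  have i := dsum_zerol vA vB zA.
  apply/idP/idP; first by apply: isob_trans => //; apply: isob_sym; rewrite ?dsum_valid.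
  by apply: isob_trans; rewrite ?dsum_valid.
have [zB|nB] := boolP (isZero B).
  rewrite mul0r mulr1 addr0; congr (nat_of_bool _)%:R.
  have i := dsum_zeror vA vB zB.
  apply/idP/idP; first by apply: isob_trans => //; apply: isob_sym; rewrite ?dsum_valid.
  by apply: isob_trans; rewrite ?dsum_valid.
rewrite mul0r mulr0 addr0; case: (boolP (isob (dsum A B) N)) => // i.
case: ind; exists A, B; split=> //; apply: isob_sym => //; exact: dsum_valid.
Qed.

(** * Values on iterated direct sums *)

Definition nz M := valid M && ~~ isZero M.
Definition bigsum Ns : rep Q := foldr (@dsum Q) (rep0 Q) Ns.

Lemma bigsum_valid Ns : all (@valid Q) Ns -> valid (bigsum Ns).
Proof.
elim: Ns => [|N Ns IH] /=; first by rewrite rep0_valid.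
by move=> /andP[vN /IH]; exact: dsum_valid.
Qed.

Lemma nz_valid Ns : all nz Ns -> all (@valid Q) Ns.
Proof. by apply: sub_all => M /andP[]. Qed.

Lemma bigsum_cat Ns Us : all (@valid Q) Ns -> all (@valid Q) Us ->
  isob (bigsum (Ns ++ Us)) (dsum (bigsum Ns) (bigsum Us)).
Proof.
move=> vN vU; elim: Ns vN => [|N Ns IH] /=.
  move=> _; apply: isob_sym; first by rewrite dsum_valid ?rep0_valid ?bigsum_valid.
  by apply: dsum_zerol; rewrite ?rep0_valid ?bigsum_valid ?rep0_zero.
move=> /andP[vn vN]; have vb := bigsum_valid vN; have vu := bigsum_valid vU.
have vNU : valid (bigsum (Ns ++ Us)) by rewrite bigsum_valid // all_cat vN.
apply: isob_trans (dsum_iso vn vNU (isob_refl vn) (IH vN)) _; first exact: dsum_valid.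
by apply: isob_sym; [rewrite !dsum_valid | exact: dsumA].
Qed.

(* The elements of filtration degree less than [m]. *)
Definition vanish m g := forall Ns, all nz Ns -> (m <= size Ns)%N -> g (bigsum Ns) = 0.

Lemma vanish_le m m' g : (m <= m')%N -> vanish m g -> vanish m' g.
Proof. by move=> mm H Ns nN le; apply: H => //; exact: leq_trans le. Qed.

Lemma vanish_add m f g : vanish m f -> vanish m g -> vanish m (hadd f g).
Proof. by move=> Hf Hg Ns nN le; rewrite /hadd Hf // Hg // addr0. Qed.

Lemma vanish_scale m c f : vanish m f -> vanish m (hscale c f).
Proof. by move=> Hf Ns nN le; rewrite /hscale Hf // mulr0. Qed.

Lemma vanish_dsum m g A : nz A -> vanish m.+1 g -> vanish m (fun X => g (dsum A X)).
Proof. by move=> nA H Ns nN le; apply: (H (A :: Ns)); rewrite //= nA. Qed.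

Lemma vanish_sub m g A Ns : inv1 g -> vanish m g -> valid A -> all nz Ns -> (m <= size Ns)%N ->
  g (dsum A (bigsum Ns)) = 0.
Proof.
move=> Ig H vA nN le; have vb := bigsum_valid (nz_valid nN).
have [zA|nA] := boolP (isZero A).
  by rewrite (Ig _ (bigsum Ns)) ?H ?dsum_valid //; exact: dsum_zerol.
by apply: (H (A :: Ns)); rewrite /= ?nN ?andbT /nz ?vA //; exact: leqW.
Qed.

Lemma vanish0 g M : inv1 g -> vanish 0 g -> valid M -> g M = 0.
Proof.
move=> Ig H vM; rewrite -(@vanish_sub 0 g M [::]) //=.
apply: Ig; rewrite ?dsum_valid ?rep0_valid //.
by apply: isob_sym (dsum_zeror _ _ _); rewrite ?dsum_valid ?rep0_valid ?rep0_zero.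
Qed.

(** Apply the Leibniz rule to the first factor [A]. When [x] acts on [A], the remaining factors
    already make [g] vanish; when it acts on the rest, [fun Y => g (dsum A Y)] has one degree less
    and induction applies. *)
Lemma vanish_mul m x g : inv1 x -> primitive x -> inv1 g -> vanish m g -> vanish m.+1 (hmul x g).
Proof.
move=> Ix px; elim: m g => [|m IH] g Ig H Ns nN le.
  have vN := bigsum_valid (nz_valid nN); rewrite /hmul vN big1 // => S sS.
  by rewrite (vanish0 Ig H) ?mulr0 ?sub_valid.
case: Ns nN le => // A Ns /= /andP[nA nN] le; have /andP[vA _] := nA.
have vN := bigsum_valid (nz_valid nN).
rewrite hmul_prim_dsum // (IH (fun Y => g (dsum A Y))) ?addr0 //; last first.
- exact: vanish_dsum.
- exact: inv1_dsuml.
by rewrite /hmul vA big1 // => S sS; rewrite (@vanish_sub m.+1) ?mulr0 ?sub_valid.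
Qed.

(** Choices are made by position, so repeated factors count separately. Equality on [rep] is not
    decidable, hence [List.In] below. *)
Fixpoint picks Ns : seq (rep Q * seq (rep Q)) :=
  if Ns is A :: Ns' then (A, Ns') :: [seq (p.1, A :: p.2) | p <- picks Ns'] else [::].

Lemma picksP p Ns : List.In p (picks Ns) -> exists l r, Ns = l ++ p.1 :: r /\ p.2 = l ++ r.
Proof.
elim: Ns p => //= A Ns IH p [<-|]; first by exists [::], Ns.
move/List.in_map_iff=> [q [<- /IH[l [r [-> ->]]]]].
by exists (A :: l), r.
Qed.

(** With exactly [m.+1] factors, any non-zero remainder of the factor hit by [x] leaves [g] too many
    summands; only the terms where [x] consumes a whole factor survive. *)
Lemma hmul_top m x g Ns : inv1 x -> primitive x -> inv1 g -> vanish m.+1 g ->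
  all nz Ns -> size Ns = m.+1 ->
  hmul x g (bigsum Ns) = \sum_(p <- picks Ns) x p.1 * g (bigsum p.2).
Proof.
move=> Ix px; elim: Ns m g => //= A Ns IH m g Ig H /andP[nA nN] [sN].
have /andP[vA _] := nA; have vN := bigsum_valid (nz_valid nN).
rewrite hmul_prim_dsum // big_cons /= big_map /=; congr (_ + _).
  rewrite -[in RHS](@hmulr1 Q K x A) // /hmul vA big_distrl /=; apply: eq_bigr => S sS.
  have vS := sub_valid vA sS; rewrite -mulrA; congr (_ * _).
  rewrite /hone vS /=; have [zS|nS] := boolP (isZero (sub S)).
    by rewrite mul1r; apply: Ig => //; rewrite ?dsum_valid //; exact: dsum_zerol.
  rewrite mul0r; apply: (H (sub S :: Ns)); rewrite /= ?nN ?andbT /nz ?vS //= sN //.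
(* After a single factor the rest of the sum is zero, where the primitive [x] vanishes. *)
case: m sN H => [|m] sN H.
  by case: Ns sN {IH nN vN} => //= _; rewrite big_nil hmul_rep0 ?prim_rep0 ?mul0r //; exact: inv1_dsuml.
by rewrite (IH m) //; [exact: inv1_dsuml | exact: vanish_dsum].
Qed.

Definition word ws : rep Q -> K := foldr (fun w g => hmul (delta K w) g) (hone K) ws.

Definition indec_rep M := valid M /\ indecomposable M.

Lemma word_inv ws : inv1 (word ws).
Proof. elim: ws => [|w ws IH] /=; [exact: hone_inv | exact: hmul_inv (@delta_inv w) IH]. Qed.

Lemma word_vanish ws : List.Forall indec_rep ws -> vanish (size ws).+1 (word ws).
Proof.
elim=> [|w {}ws [vw iw] _ IH] /=.
  by case=> // A Ns /= /andP[/andP[vA nA] _] _; rewrite /hone isZero_dsum (negbTE nA) andbF.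
apply: vanish_mul => //; [exact: delta_inv | exact: delta_prim | exact: word_inv].
Qed.

(* The number of bijections from [ws] to [Us] matching isomorphic
   representations. *)
Fixpoint matchings ws Us : nat :=
  if ws is w :: ws' then \sum_(p <- picks Us) isob p.1 w * matchings ws' p.2
  else nilp Us.

Lemma size_picks p Ns : List.In p (picks Ns) -> size Ns = (size p.2).+1.
Proof. by move/picksP=> [l [r [-> ->]]]; rewrite !size_cat /= addnS. Qed.

Lemma all_picks (a : pred (rep Q)) p Ns : List.In p (picks Ns) -> all a Ns -> a p.1 /\ all a p.2.
Proof.
by move/picksP=> [l [r [-> ->]]]; rewrite !all_cat /= => /and3P[-> -> ->].
Qed.

Lemma eq_big_In (R : Type) (idx : R) (op : R -> R -> R) (I : Type) (s : seq I) (F G : I -> R) :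
  (forall i, List.In i s -> F i = G i) -> \big[op/idx]_(i <- s) F i = \big[op/idx]_(i <- s) G i.
Proof.
elim: s => [|a s IH] H; first by rewrite !big_nil.
by rewrite !big_cons IH ?(H a) //=; [left | move=> i i_s; apply: H; right].
Qed.

Lemma sum_nat_gt0_In (I : Type) (s : seq I) (F : I -> nat) :
  (0 < \sum_(i <- s) F i)%N -> exists i, List.In i s /\ (0 < F i)%N.
Proof.
elim: s => [|a s IH]; first by rewrite big_nil.
rewrite big_cons addn_gt0 => /orP[H|/IH[i [i_s H]]]; first by exists a; split; [left|].
by exists i; split=> //; right.
Qed.

Lemma word_top ws Ns : List.Forall indec_rep ws -> all nz Ns -> size Ns = size ws ->
  word ws (bigsum Ns) = (matchings ws Ns)%:R.
Proof.
move=> gw; elim: gw Ns => [|w {}ws [vw iw] gws IH] Ns nN /= sN.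
  by case: Ns sN nN => //= _ _; rewrite /hone rep0_valid rep0_zero.
rewrite (hmul_top _ _ _ (word_vanish gws) nN sN); last 3 first.
- exact: delta_inv.
- exact: delta_prim.
- exact: word_inv.
rewrite natr_sum; apply: eq_big_In => p pin.
have [/andP[vp _] np] := all_picks pin nN.
rewrite IH // ?natrM /delta ?vp //.
by have := size_picks pin; rewrite sN => -[].
Qed.

Lemma matchings_size ws Us : (0 < matchings ws Us)%N -> size Us = size ws.
Proof.
elim: ws Us => [|w ws IH] Us /=; first by case: Us.
move/sum_nat_gt0_In=> [p [pin]]; rewrite muln_gt0 => /andP[_ /IH].
by rewrite (size_picks pin) => ->.
Qed.

Lemma matchings_refl ws : all (@valid Q) ws -> (0 < matchings ws ws)%N.
Proof.
elim: ws => //= w ws IH /andP[vw vs]; rewrite big_cons /= isob_refl // mul1n addn_gt0.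
by rewrite IH.
Qed.

Lemma picks_iso p Ns : all (@valid Q) Ns -> List.In p (picks Ns) ->
  isob (bigsum Ns) (dsum p.1 (bigsum p.2)).
Proof.
elim: Ns p => //= A Ns IH p /andP[vA vN] [<-|] /=.
  by apply: isob_refl; rewrite dsum_valid ?bigsum_valid.
move/List.in_map_iff=> [q [<- qin]] /=.
have [vq1 vq2] := all_picks qin vN; have vb := bigsum_valid vq2; have vbN := bigsum_valid vN.
apply: isob_trans (dsum_iso vA vbN (isob_refl vA) (IH _ vN qin)) _; first by rewrite dsum_valid.
exact: dsumCA.
Qed.

Lemma matchings_iso ws Us : all (@valid Q) ws -> all (@valid Q) Us -> (0 < matchings ws Us)%N ->
  isob (bigsum Us) (bigsum ws).
Proof.
elim: ws Us => [|w ws IH] Us /=.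
  by case: Us => // _ _ _; apply: isob_refl; exact: rep0_valid.
move=> /andP[vw vs] vU /sum_nat_gt0_In[p [pin]]; rewrite muln_gt0 lt0b => /andP[i mp].
have [vp1 vp2] := all_picks pin vU.
apply: isob_trans (picks_iso vU pin) _; first by rewrite bigsum_valid.
by apply: dsum_iso => //; [exact: bigsum_valid | exact: IH].
Qed.

Lemma not_indec M : valid M -> ~~ isZero M -> ~ indecomposable M ->
  exists A B, [/\ nz A, nz B & isob M (dsum A B)].
Proof.
move=> vM nM H; case: (classic (exists A B, [/\ nz A, nz B & isob M (dsum A B)])) => // H'.
case: H; split=> // -[A [B [vA vB nA nB i]]]; apply: H'.
by exists A, B; rewrite /nz vA vB.
Qed.

Lemma decomposition M : valid M -> exists Ns, List.Forall indec_rep Ns /\ isob M (bigsum Ns).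
Proof.
have [n] := ubnP (tdim M); elim: n M => // n IH M ltn vM.
have [zM|nM] := boolP (isZero M).
  by exists [::]; split=> //; apply: isob_sym (zero_iso0 vM zM); exact: rep0_valid.
case: (classic (indecomposable M)) => [iM|/(not_indec vM nM)[A [B [nA nB i]]]].
  exists [:: M]; split; first by constructor.
  by apply: isob_sym (dsum_zeror _ _ _); rewrite ?dsum_valid ?rep0_valid ?rep0_zero.
have /andP[vA zA] := nA; have /andP[vB zB] := nB.
have eD : tdim M = (tdim A + tdim B)%N by rewrite (tdim_iso i) tdim_dsum.
rewrite tdim_zero in zA; rewrite tdim_zero in zB; rewrite -lt0n in zA; rewrite -lt0n in zB.
have [|LA [gA iA]] := IH A _ vA.
  by rewrite (leq_trans _ (ltn : (tdim M <= n)%N)) // eD -addn1 leq_add2l.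
have [|LB [gB iB]] := IH B _ vB.
  by rewrite (leq_trans _ (ltn : (tdim M <= n)%N)) // eD -add1n leq_add2r.
have va Ls : List.Forall indec_rep Ls -> all (@valid Q) Ls.
  by elim=> //= N Ns [-> _] _.
exists (LA ++ LB); split; first by apply/List.Forall_app.
apply: isob_trans i _ => //.
apply: isob_trans (dsum_iso vA vB iA iB) _; first exact: dsum_valid.
apply: isob_sym; first by rewrite bigsum_valid // all_cat !va.
by apply: bigsum_cat; exact: va.
Qed.

Lemma indec_nz Ls : List.Forall indec_rep Ls -> all nz Ls.
Proof. by elim=> //= N Ns [vN [zN _]] _ ->; rewrite /nz vN zN. Qed.

(** Refining never shortens a list of non-zero factors, so [vanish] can be tested on indecomposable
    factors alone. *)
Lemma indec_refinement Ns : all nz Ns -> exists Ls,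
  [/\ List.Forall indec_rep Ls, (size Ns <= size Ls)%N & isob (bigsum Ns) (bigsum Ls)].
Proof.
elim: Ns => [_|N Ns IH /= /andP[nN nNs]].
  by exists [::]; split=> //; apply: isob_refl; exact: rep0_valid.
have [Ls [gL sL iL]] := IH nNs; have /andP[vN zN] := nN.
have [L1 [g1 i1]] := decomposition vN.
have v1 := nz_valid (indec_nz g1); have v2 := nz_valid (indec_nz gL).
exists (L1 ++ Ls); split; first by apply/List.Forall_app.
  rewrite size_cat -add1n leq_add //; case: L1 i1 {g1 v1} => // i1.
  by rewrite (isob_zero i1) rep0_zero in zN.
have vNs := bigsum_valid (nz_valid nNs).
apply: isob_trans (dsum_iso vN vNs i1 iL) _; first exact: dsum_valid.
by apply: isob_sym (bigsum_cat v1 v2); rewrite bigsum_valid // all_cat v1.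
Qed.

Lemma tdim_bigsum Ns : all nz Ns -> (size Ns <= tdim (bigsum Ns))%N.
Proof.
elim: Ns => //= N Ns IH /andP[/andP[_ zN] /IH H]; rewrite tdim_dsum -add1n leq_add //.
by rewrite tdim_zero -lt0n in zN.
Qed.

(** * The Hall algebra of a subcategory and its primitive elements *)

Section Subcategory.
Variable P : rep Q -> Prop.
(** [P_zero] puts the unit and [P_ext] the products into the algebra; [P_dsum] keeps the
    indecomposable summands of an object of [P] in [P]. *)
Hypothesis P_zero : forall M, valid M -> isZero M -> P M.
Hypothesis P_iso : forall M N, valid M -> isob M N -> P M -> P N.
Hypothesis P_dsum : forall A B, valid A -> valid B -> P (dsum A B) -> P A /\ P B.
Hypothesis P_ext : forall M (T : subsets_of M), valid M -> is_subrep T -> P (quo T) -> P (sub T) -> P M.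

Definition good M := [/\ valid M, P M & indecomposable M].

Lemma good_indec ws : List.Forall good ws -> List.Forall indec_rep ws.
Proof. by apply: List.Forall_impl => M []. Qed.

Lemma P_bigsum Ns : List.Forall indec_rep Ns -> P (bigsum Ns) -> List.Forall good Ns.
Proof.
elim=> [|N Ls [vN iN] gL IH] //= pN.
have [p1 p2] := P_dsum vN (bigsum_valid (nz_valid (indec_nz gL))) pN.
by constructor; [split | exact: IH].
Qed.

Lemma inHE f : inH P f <-> [/\ forall M, ~~ valid M -> f M = 0,
   forall M, valid M -> f M != 0 -> P M, inv1 f &
   exists D, forall M, valid M -> f M != 0 -> forall i, (rdim M i <= D)%N].
Proof.
split=> -[H1 H2 H3 [D H4]].
  split=> //.
    by move=> M vM; case: (classic (P M)) => // np /eqP; case; exact: H2.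
  case: H4 => g H4; exists (\max_j \max_i rdim (g j) i)%N => M vM /(H4 M vM)[j ij] i.
  rewrite (isob_dim i ij); apply: leq_trans (leq_bigmax j).
  exact: leq_bigmax.
split=> //.
  by move=> M vM np; case: (eqVneq (f M) 0) => // /(H2 M vM).
have [k [g H]] := bounded_fin Q D; exists k, g => M vM nf; apply: H => //; exact: H4.
Qed.

Lemma inH_inv f : inH P f -> inv1 f.
Proof. by move/inHE=> []. Qed.

Lemma inH_zero : inH P hzero.
Proof. by apply/inHE; split=> //; [move=> M _; rewrite eqxx | exists 0%N => M _; rewrite eqxx]. Qed.

Lemma inH_add f g : inH P f -> inH P g -> inH P (hadd f g).
Proof.
move=> /inHE[f1 f2 f3 [Df f4]] /inHE[g1 g2 g3 [Dg g4]]; apply/inHE.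
have ne M : hadd f g M != 0 -> f M != 0 \/ g M != 0.
  case: (eqVneq (f M) 0) => [f0|]; [right | by left].
  by rewrite /hadd f0 add0r in H *.
split; [| |exact: inv1_add|].
- by move=> M vM; rewrite /hadd f1 // g1 // addr0.
- by move=> M vM /ne[]; [exact: f2 | exact: g2].
exists (maxn Df Dg) => M vM /ne[nf|nf] i; rewrite leq_max.
  by rewrite f4.
by rewrite g4 // orbT.
Qed.

Lemma inH_scale c f : inH P f -> inH P (hscale c f).
Proof.
move=> /inHE[f1 f2 f3 [D f4]]; apply/inHE.
have ne M : hscale c f M != 0 -> f M != 0 by rewrite mulf_eq0 negb_or => /andP[].
split; [| |exact: inv1_scale|].
- by move=> M vM; rewrite /hscale f1 // mulr0.
- by move=> M vM /ne; exact: f2.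
by exists D => M vM /ne; exact: f4.
Qed.

Lemma inH_mul f g : inH P f -> inH P g -> inH P (hmul f g).
Proof.
move=> /inHE[f1 f2 f3 [Df f4]] /inHE[g1 g2 g3 [Dg g4]]; apply/inHE.
have ne M : valid M -> hmul f g M != 0 ->
    exists T : subsets_of M, [/\ is_subrep T, f (quo T) != 0 & g (sub T) != 0].
  move=> vM; rewrite /hmul vM => nz0.
  case: (boolP [exists T : subsets_of M, [&& is_subrep T, f (quo T) != 0 & g (sub T) != 0]]).
    by move/existsP=> [T /and3P[? ? ?]]; exists T.
  rewrite negb_exists => /forallP H; case/eqP: nz0; apply: big1 => T sT; apply/eqP.
  by have := H T; rewrite sT /= negb_and !negbK mulf_eq0.
split; [| |exact: hmul_inv|].
- by move=> M; exact: hmul_nonvalid.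
- move=> M vM /(ne _ vM)[T [sT nf ng]]; apply: (P_ext vM sT).
    by apply: f2 => //; exact: quo_valid.
  by apply: g2 => //; exact: sub_valid.
exists (Dg + Df)%N => M vM /(ne _ vM)[T [sT nf ng]] i.
by rewrite (subquo_dim i vM sT) leq_add ?g4 ?f4 ?sub_valid ?quo_valid.
Qed.

Lemma inH_one : inH P (hone K).
Proof.
apply/inHE; have ne M : hone K M != 0 -> isZero M.
  by rewrite /hone; case: (isZero M) => //; rewrite andbF eqxx.
split; [| |exact: hone_inv|].
- by move=> M /negbTE v; rewrite /hone v.
- by move=> M vM /ne; exact: P_zero.
by exists 0%N => M vM /ne/isZeroP H i; rewrite H.
Qed.

Lemma inH_delta N : valid N -> P N -> inH P (delta K N).
Proof.
move=> vN PN; apply/inHE; have ne M : delta K N M != 0 -> isob M N.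
  by rewrite /delta; case: (isob M N) => //; rewrite andbF eqxx.
split; [| |exact: delta_inv|].
- by move=> M /negbTE v; rewrite /delta v.
- by move=> M vM /ne i; apply: P_iso PN => //; exact: isob_sym.
exists (\max_i rdim N i)%N => M vM /ne i j; rewrite (isob_dim j i); exact: leq_bigmax.
Qed.

Lemma inH_word ws : List.Forall good ws -> inH P (word ws).
Proof.
elim=> [|w {}ws [vw Pw iw] _ IH]; first exact: inH_one.
by apply: inH_mul => //; exact: inH_delta.
Qed.

(** Inductive form of [span_indec], for linear arguments one term at a time. *)
Inductive indec_span : (rep Q -> K) -> Prop :=
| indec_span0 : indec_span hzero
| indec_spanS c N x : good N -> indec_span x -> indec_span (hadd (hscale c (delta K N)) x).

Lemma indec_spanP x : span_indec P x <-> indec_span x.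
Proof.
split=> [[k [c [g [Hg Hx]]]]|].
  have -> : x = (fun M => \sum_(j < k) c j * delta K (g j) M) by exact: functional_extensionality.
  elim: k c g Hg {Hx} => [|k IH] c g Hg.
    have -> : (fun M => \sum_(j < 0) c j * delta K (g j) M) = hzero.
      by apply: functional_extensionality => M; rewrite big_ord0.
    exact: indec_span0.
  have -> : (fun M => \sum_(j < k.+1) c j * delta K (g j) M) =
     hadd (hscale (c ord0) (delta K (g ord0))) (fun M => \sum_(j < k) c (lift ord0 j) * delta K (g (lift ord0 j)) M).
    by apply: functional_extensionality => M; rewrite big_ord_recl.
  apply: indec_spanS; first exact: Hg.
  by apply: (IH (fun j => c (lift ord0 j)) (fun j => g (lift ord0 j))) => j; exact: Hg.
elim=> [|c N {}x gN _ [k [c' [g [Hg Hx]]]]].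
  by exists 0%N, (fun _ => 0), (fun _ => rep0 Q); split=> [[]|M] //; rewrite big_ord0.
exists k.+1, (fun j => if unlift ord0 j is Some i then c' i else c),
  (fun j => if unlift ord0 j is Some i then g i else N); split.
  by move=> j; case: (unlift ord0 j).
move=> M; rewrite big_ord_recl unlift_none /hadd Hx; congr (_ + _).
by apply: eq_bigr => j _; rewrite liftK.
Qed.

Lemma prim_support x M : inH P x -> primitive x -> x M != 0 -> good M.
Proof.
move=> hx px nx; have /inHE[h1 h2 h3 _] := hx.
have vM : valid M by apply: contraNT nx => /h1->.
have nM : ~~ isZero M.
  apply: contraNN nx => zM; rewrite -(h3 (rep0 Q)) ?prim_rep0 //; first exact: rep0_valid.
  exact: zero_iso0.
split=> //; first exact: h2.
split=> // -[A [B [vA vB nA nB i]]]; case/eqP: nx.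
rewrite (h3 _ (dsum A B)) ?dsum_valid // primE // /hone (negbTE nA) (negbTE nB) !andbF.
by rewrite mul0r mulr0 addr0.
Qed.

Lemma inH_cover f : inH P f -> exists gs : seq (rep Q),
  forall M, valid M -> f M != 0 -> has (isob M) gs.
Proof.
move=> [_ _ _ [k [g H]]]; exists [seq g j | j <- enum 'I_k] => M vM /(H M vM)[j ij].
by rewrite has_map; apply/hasP; exists j => //; exact: mem_enum.
Qed.

Lemma hsubE f g M : hadd f (hscale (-1) g) M = f M - g M.
Proof. by rewrite /hadd /hscale mulN1r. Qed.

Lemma prim_span x : inH P x /\ primitive x <-> indec_span x.
Proof.
split; last first.
  elim=> [|c N {}x [vN PN iN] _ [hx px]]; first by split; [exact: inH_zero | exact: primitive0].
  split; first by apply: inH_add => //; apply: inH_scale; exact: inH_delta.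
  by apply: primitive_add => //; apply: primitive_scale; exact: delta_prim.
move=> [hx px]; have [gs Hgs] := inH_cover hx.
elim: gs x hx px Hgs => [|N gs IH] x hx px Hgs.
  have -> : x = hzero; last exact: indec_span0.
  apply: functional_extensionality => M; apply/eqP; apply: contraT => nx.
  by have [vM _ _] := prim_support hx px nx; have := Hgs M vM nx.
have [x0|nx] := eqVneq (x N) 0.
  apply: IH => // M vM nx; have /orP[i|] := Hgs M vM nx => //.
  by rewrite (inH_inv hx vM (isob_valid vM i) i) x0 eqxx in nx.
have gN := prim_support hx px nx; have [vN PN iN] := gN.
(* [x'] vanishes on the class of [N] and is unchanged elsewhere, so the shorter cover [gs] suffices
   for it. *)
set x' := hadd x (hscale (- x N) (delta K N)).
have -> : x = hadd (hscale (x N) (delta K N)) x'.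
  by apply: functional_extensionality => M; rewrite /x' /hadd /hscale; ring.
apply: indec_spanS => //; apply: IH.
- by apply: inH_add => //; apply: inH_scale; exact: inH_delta.
- by apply: primitive_add => //; apply: primitive_scale; exact: delta_prim.
move=> M vM; rewrite /x' /hadd /hscale /delta vM /=.
case: (boolP (isob M N)) => i; rewrite ?mulr1 ?mulr0 ?addr0.
  by rewrite (inH_inv hx vM vN i) subrr eqxx.
by move=> /(Hgs M vM) /=; rewrite (negbTE i).
Qed.

(** Read off from the primitive side: brackets of primitives are primitive, and primitives lie in
    the span. No structure constants are computed. *)
Lemma span_bracket x y : indec_span x -> indec_span y -> indec_span (hbr x y).
Proof.
move=> /prim_span[hx px] /prim_span[hy py]; apply/prim_span; split; last first.
  by apply: primitive_bracket => //; exact: inH_inv.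
have -> : hbr x y = hadd (hmul x y) (hscale (-1) (hmul y x)).
  by apply: functional_extensionality => M; rewrite hsubE.
by apply: inH_add; [|apply: inH_scale]; exact: inH_mul.
Qed.

Lemma span_delta N : good N -> indec_span (delta K N).
Proof. by move=> [vN PN iN]; apply/prim_span; split; [exact: inH_delta | exact: delta_prim]. Qed.
End Subcategory.
End HallAlgebra.

(** * The universal property *)

Section Envelope.
Variables (Q : quiver) (K : fieldType).
Hypothesis charK0 : [pchar K] =i pred0.
Variable P : rep Q -> Prop.
Hypothesis P_zero : forall M, valid M -> isZero M -> P M.
Hypothesis P_iso : forall M N, valid M -> isob M N -> P M -> P N.
Hypothesis P_dsum : forall A B, valid A -> valid B -> P (dsum A B) -> P A /\ P B.
Hypothesis P_ext : forall M (T : subsets_of M), valid M -> is_subrep T -> P (quo T) -> P (sub T) -> P M.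
Implicit Types (f g x y : rep Q -> K) (u v w Us ws : seq (rep Q)).
Local Notation prim x := (inH P x /\ primitive x).
Local Notation good := (good P).
Local Notation word := (word K).
Local Notation delta := (delta K).

(** * Words and their images in a target algebra *)

Section Target.
Variables (A : algType K) (phi : (rep Q -> K) -> A).
Hypothesis phiL : lie_map_on (fun x => prim x) phi.

Definition wordA ws : A := foldr (fun M a => phi (delta M) * a) 1 ws.

Lemma prim_delta N : good N -> prim (delta N).
Proof. by move=> gN; apply/(prim_span P_iso)/span_delta. Qed.

Lemma phi0 : phi (hzero K) = 0.
Proof.
have p0 : prim (@hzero Q K) by split; [exact: inH_zero | exact: primitive0].
have [H _] := phiL; have := H 1 _ _ p0 p0.
have -> : hadd (hscale 1 (@hzero Q K)) (hzero K) = hzero K.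
  by apply: functional_extensionality => M; rewrite /hadd /hscale /hzero mulr0 addr0.
by rewrite scale1r => /esym/eqP; rewrite -subr_eq0 addrK => /eqP.
Qed.

Lemma phi_span c N x : good N -> indec_span P x ->
  phi (hadd (hscale c (delta N)) x) = c *: phi (delta N) + phi x.
Proof.
by move=> gN sx; have [H _] := phiL; apply: H; [exact: prim_delta | apply/(prim_span P_iso)].
Qed.

Lemma phi_br x y : indec_span P x -> indec_span P y ->
  phi (hbr x y) = phi x * phi y - phi y * phi x.
Proof. by move=> sx sy; have [_ H] := phiL; apply: H; apply/(prim_span P_iso). Qed.

(* The part of degree less than [d] of the graph of the extension of [phi]; that
   this relation is a function is [words_fun]. *)
Inductive words (d : nat) : (rep Q -> K) -> A -> Prop :=
| words_nil : words d (hzero K) 0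
| words_cons c w f a : List.Forall good w -> (size w < d)%N -> words d f a ->
    words d (hadd (hscale c (word w)) f) (c *: wordA w + a).

Lemma words_ext d f g a b : f =1 g -> a = b -> words d f a -> words d g b.
Proof. by move=> /functional_extensionality-> ->. Qed.

Lemma words_add d f g a b : words d f a -> words d g b -> words d (hadd f g) (a + b).
Proof.
move=> Wf Wg; elim: Wf => [|c w {}f {}a gw sw _ IH].
  by apply: words_ext Wg; rewrite ?add0r // => M; rewrite /hadd /hzero add0r.
apply: words_ext (words_cons c gw sw IH); last by rewrite addrA.
by move=> M; rewrite /hadd addrA.
Qed.

Lemma words_scale d c f a : words d f a -> words d (hscale c f) (c *: a).
Proof.
elim=> [|c' w {}f {}a gw sw _ IH].
  by apply: words_ext (words_nil d); rewrite ?scaler0 // => M; rewrite /hscale /hzero mulr0.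
apply: words_ext (words_cons (c * c') gw sw IH); last by rewrite scalerDr scalerA.
by move=> M; rewrite /hadd /hscale mulrDr mulrA.
Qed.

Lemma words_sub d f g a b : words d f a -> words d g b ->
  words d (hadd f (hscale (-1) g)) (a - b).
Proof. by move=> Wf Wg; rewrite -scaleN1r; exact: words_add Wf (words_scale _ Wg). Qed.

Lemma words_le d d' f a : (d <= d')%N -> words d f a -> words d' f a.
Proof.
move=> dd; elim=> [|c w {}f {}a gw sw _ IH]; first exact: words_nil.
by apply: words_cons => //; exact: leq_trans dd.
Qed.

Lemma words_word d w : List.Forall good w -> (size w < d)%N -> words d (word w) (wordA w).
Proof.
move=> gw sw; apply: words_ext (words_cons 1 gw sw (words_nil d)); last by rewrite scale1r addr0.
by move=> M; rewrite /hadd /hscale /hzero mul1r addr0.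
Qed.

Lemma words_mull d N f a : good N -> words d f a ->
  words d.+1 (hmul (delta N) f) (phi (delta N) * a).
Proof.
move=> gN; elim=> [|c w {}f {}a gw sw _ IH].
  by rewrite mulr0 hmul0r; exact: words_nil.
apply: words_ext (words_cons c (_ : List.Forall good (N :: w)) _ IH) => //=.
- by move=> M; rewrite hmulDr hmulZr.
- by rewrite mulrDr scalerAr.
- by constructor.
Qed.

(** Any combination of indecomposables counts as one letter. Applied to a bracket, this yields words
    shorter than the two whose difference it is. *)
Lemma words_span d x w : indec_span P x -> List.Forall good w -> (size w < d)%N ->
  words d.+1 (hmul x (word w)) (phi x * wordA w).
Proof.
move=> sx gw sw; elim: sx => [|c N {}x gN sx IH].
  by rewrite hmul0l phi0 mul0r; exact: words_nil.
rewrite phi_span // mulrDl hmulDl hmulZl -scalerAl; apply: words_add => //.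
by apply: words_scale; apply: words_mull => //; exact: words_word.
Qed.

Lemma words_vanish d f a : words d f a -> vanish d f.
Proof.
elim=> [|c w {}f {}a gw sw _ IH]; first by [].
apply: vanish_add => //; apply: vanish_scale.
by apply: vanish_le sw _; apply: word_vanish; exact: good_indec gw.
Qed.

Lemma wordA_cat u v : wordA (u ++ v) = wordA u * wordA v.
Proof. by elim: u => [|w u IH] /=; rewrite ?mul1r // IH mulrA. Qed.

Lemma word_nonvalid w M : ~~ valid M -> word w M = 0.
Proof. by case: w => [|w ws] v /=; [rewrite /hone (negbTE v) | exact: hmul_nonvalid]. Qed.

Lemma word_cat u v : word (u ++ v) = hmul (word u) (word v).
Proof.
elim: u => [|w u IH] /=.
  apply: functional_extensionality => M; case: (boolP (valid M)) => vM.
    by rewrite hmul1r //; exact: word_inv.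
  by rewrite word_nonvalid // hmul_nonvalid.
rewrite IH hmulA //; [exact: delta_inv | exact: word_inv | exact: word_inv].
Qed.

Lemma words_mul d e f g a b : words d f a -> words e g b -> words (d + e) (hmul f g) (a * b).
Proof.
move=> Wf Wg; elim: Wf => [|c u {}f {}a gu su _ IH].
  by rewrite hmul0l mul0r; exact: words_nil.
rewrite hmulDl hmulZl mulrDl -scalerAl; apply: words_add IH; apply: words_scale.
elim: Wg => [|c' v {}g {}b gv sv _ IH].
  by rewrite hmul0r mulr0; exact: words_nil.
rewrite hmulDr hmulZr mulrDr -scalerAr; apply: words_add IH; apply: words_scale.
rewrite -word_cat -wordA_cat; apply: words_word; first by apply/List.Forall_app.
by rewrite size_cat -addnS leq_add // ltnW.
Qed.

(** The difference is [w] preceded by the bracket of the two letters, on both sides because [phi] is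
    a Lie map. The index is a strict bound: [(size w).+2] admits words one letter shorter than those
    compared. *)
Lemma words_swap M N w : good M -> good N -> List.Forall good w ->
  words (size w).+2
    (hadd (word [:: M, N & w]) (hscale (-1) (word [:: N, M & w])))
    (wordA [:: M, N & w] - wordA [:: N, M & w]).
Proof.
move=> gM gN gw; have sM := span_delta K P_iso gM; have sN := span_delta K P_iso gN.
have sb := span_bracket P_iso P_ext sM sN.
apply: words_ext (words_span sb gw (ltnSn _)); last by rewrite phi_br //= mulrBl !mulrA.
move=> X /=; have -> : hbr (delta M) (delta N) =
    hadd (hmul (delta M) (delta N)) (hscale (-1) (hmul (delta N) (delta M))).
  by apply: functional_extensionality => Y; rewrite hsubE.
have Iw := @word_inv Q K w.
rewrite hmulDl hmulZl !hmulA //; exact: delta_inv.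
Qed.

Lemma words_move M u v : good M -> List.Forall good u -> List.Forall good v ->
  words (size u + size v).+1
    (hadd (word (M :: u ++ v)) (hscale (-1) (word (u ++ M :: v))))
    (wordA (M :: u ++ v) - wordA (u ++ M :: v)).
Proof.
move=> gM gu gv; elim: gu => [|N {}u gN gu IH].
  apply: words_ext (words_nil _); last by rewrite subrr.
  by move=> X; rewrite hsubE subrr.
have guv : List.Forall good (u ++ v) by apply/List.Forall_app.
have H1 := words_swap gM gN guv; have H2 := words_mull gN IH.
rewrite size_cat in H1.
apply: words_ext (words_add H1 H2) => [X|].
  by rewrite hmulDr hmulZr /hadd /hscale /=; ring.
by rewrite /= mulrBr addrA subrK.
Qed.

(** A matching is a permutation up to isomorphism: bring the partner of the first letter to the
    front by [words_move], identify the two letters by [delta_eq], and recurse on the tails. *)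
Lemma words_matchings ws Us : List.Forall good ws -> List.Forall good Us ->
  (0 < matchings ws Us)%N ->
  words (size ws) (hadd (word ws) (hscale (-1) (word Us))) (wordA ws - wordA Us).
Proof.
move=> gw; elim: gw Us => [|w {}ws gw gws IH] Us gU /=.
  case: Us gU => // _ _; apply: words_ext (words_nil _); last by rewrite subrr.
  by move=> X; rewrite hsubE subrr.
move/sum_nat_gt0_In=> [p [/picksP[l [r [eU ep]]]]].
rewrite muln_gt0 lt0b => /andP[i mp]; subst Us.
have /List.Forall_app[gl /List.Forall_cons_iff[gp gr]] := gU.
have gp2 : List.Forall good p.2 by rewrite ep; apply/List.Forall_app.
have H1 := words_mull gw (IH _ gp2 mp).
have H2 := words_move gp gl gr.
rewrite -size_cat -ep (matchings_size mp) in H2.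
have ed : delta p.1 = delta w by apply: delta_eq => //; [case: gp | case: gw].
apply: words_ext (words_add H1 H2) => [X|].
  by rewrite hmulDr hmulZr /hadd /hscale /= ed; ring.
by rewrite /= ed mulrBr addrA subrK.
Qed.

(* The number [n] of words of length exactly [d] is the measure for the descent
   in [topwords0]. *)
Inductive topwords (d : nat) : nat -> (rep Q -> K) -> A -> Prop :=
| topwords_nil f a : words d f a -> topwords d 0 f a
| topwords_cons n c w f a : List.Forall good w -> size w = d -> topwords d n f a ->
    topwords d n.+1 (hadd (hscale c (word w)) f) (c *: wordA w + a).

Lemma topwords_ext d n f g a b : f =1 g -> a = b -> topwords d n f a -> topwords d n g b.
Proof. by move=> /functional_extensionality-> ->. Qed.

Lemma topwords_add d n f g a b : topwords d n f a -> words d g b ->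
  topwords d n (hadd g f) (b + a).
Proof.
move=> T Wg; elim: T => [{}f {}a Wf|{}n c w {}f {}a gw sw _ IH].
  by apply: topwords_nil; exact: words_add.
apply: topwords_ext (topwords_cons c gw sw IH); last by rewrite addrCA.
by move=> M; rewrite /hadd addrCA.
Qed.

Lemma words_topwords d f a : words d.+1 f a -> exists n, topwords d n f a.
Proof.
elim=> [|c w {}f {}a gw sw _ [n IH]].
  by exists 0%N; apply: topwords_nil; exact: words_nil.
move: sw; rewrite ltnS leq_eqVlt => /orP[/eqP sw|sw].
  by exists n.+1; exact: topwords_cons.
by exists n; apply: topwords_add IH _; apply: words_scale; exact: words_word.
Qed.

Lemma good_nz w : List.Forall good w -> all (@nz Q) w.
Proof. by move=> gw; apply: indec_nz; exact: good_indec gw. Qed.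

(** Top words that match [w] are replaced by [w] itself at the cost of shorter words. Those left
    have no matching with [w], so by [word_top] the remainder vanishes at [bigsum w]. *)
Lemma topwords_collect d n f a w : List.Forall good w -> size w = d -> topwords d n f a ->
  exists c n' f' a', [/\ (n' <= n)%N, topwords d n' f' a',
    f = hadd (hscale c (word w)) f', a = c *: wordA w + a' & f' (bigsum w) = 0].
Proof.
move=> gw sw; have nw := good_nz gw; have ev g b : words d g b -> g (bigsum w) = 0.
  by move=> Wg; apply: (words_vanish Wg) => //; rewrite sw.
elim=> [{}f {}a Wf|{}n c u {}f {}a gu su _ [c' [n' [f' [a' [len T -> -> e0]]]]]].
  exists 0, 0%N, f, a; split=> //; first exact: topwords_nil.
  - by apply: functional_extensionality => M; rewrite /hadd /hscale mul0r add0r.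
  - by rewrite scale0r add0r.
  - exact: ev Wf.
have [m0|m0] := posnP (matchings u w).
  exists c', n'.+1, (hadd (hscale c (word u)) f'), (c *: wordA u + a'); split=> //.
  - exact: topwords_cons.
  - by apply: functional_extensionality => M; rewrite /hadd addrCA.
  - by rewrite addrCA.
  rewrite /hadd /hscale e0 addr0 word_top ?m0 ?mulr0 ?sw ?su //; exact: good_indec gu.
have W := words_scale c (words_matchings gu gw m0); rewrite su in W.
exists (c + c'), n', (hadd (hscale c (hadd (word u) (hscale (-1) (word w)))) f'),
  (c *: (wordA u - wordA w) + a'); split.
- exact: leqW.
- exact: topwords_add.
- by apply: functional_extensionality => M; rewrite /hadd /hscale; ring.
- by rewrite scalerDl scalerBr -!addrA [RHS]addrCA [c *: wordA w + (_ + _)]addrCA addNKr [RHS]addrCA.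
by rewrite {1}/hadd (ev _ _ W) e0 addr0.
Qed.

Lemma natr_neq0 n : (0 < n)%N -> n%:R != 0 :> K.
Proof. by move=> n0; rewrite ((pcharf0P K).1 charK0) -lt0n. Qed.

(** Gather the permutations of the first top word [w]. At [bigsum w] the relation leaves their total
    coefficient times [matchings w w], a positive integer; so that coefficient is zero, the gathered
    terms disappear in [A] as well, and fewer top words remain. *)
Lemma topwords0 d n f a : f =1 (hzero K) -> topwords d n f a -> words d f a.
Proof.
have [k] := ubnP n; elim: k n f a => // k IH n f a ltn f0 T.
case: T ltn f0 => // {}n c w {}f {}a gw sw T ltn f0.
have [c' [n' [f' [a' [len T' ef ea e0]]]]] := topwords_collect gw sw T.
have nw := good_nz gw.
have cc : c + c' = 0.
  have := f0 (bigsum w); rewrite ef /hadd /hscale e0 addr0 -mulrDl.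
  rewrite word_top ?sw //; last exact: good_indec gw.
  move/eqP; rewrite mulf_eq0 => /orP[/eqP//|].
  by rewrite (negbTE (natr_neq0 (matchings_refl (nz_valid nw)))).
have f'0 : f' =1 hzero K.
  by move=> M; have := f0 M; rewrite ef /hadd /hscale addrA -mulrDl cc mul0r add0r.
have W : words d f' a' by apply: IH T' => //; exact: leq_ltn_trans len ltn.
apply: words_ext W; last by rewrite ea addrA -scalerDl cc scale0r add0r.
by move=> M; rewrite f'0 f0.
Qed.

(** The injectivity half of the isomorphism with the enveloping algebra: every relation between
    words in the Hall algebra is forced by the bracket. *)
Lemma words0 d a : words d (hzero K) a -> a = 0.
Proof.
elim: d a => [|d IH] a W; last by apply: IH; have [n T] := words_topwords W; exact: topwords0 T.
(* No word has length below 0, so only the empty combination remains. *)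
by case: _ _ / W.
Qed.

Lemma words_fun d e f a b : words d f a -> words e f b -> a = b.
Proof.
move=> Wa Wb; apply/eqP; rewrite -subr_eq0; apply/eqP/(@words0 (maxn d e)).
apply: words_ext (words_sub (words_le (leq_maxl d e) Wa) (words_le (leq_maxr d e) Wb)) => //.
by move=> M; rewrite hsubE subrr.
Qed.

(** Refine to indecomposables: either the list has exactly [d] factors, which the last hypothesis
    excludes from the support, or it has more and [vanish d.+1] applies. *)
Lemma vanish_of_cover d f : inH P f -> vanish d.+1 f ->
  (forall M, valid M -> f M != 0 ->
     ~ exists Ns, [/\ List.Forall good Ns, size Ns = d & isob M (bigsum Ns)]) ->
  vanish d f.
Proof.
move=> hf vf H Ns nN le; have [Ls [gL sL iL]] := indec_refinement nN.
have vN := bigsum_valid (nz_valid nN); have vL := bigsum_valid (nz_valid (indec_nz gL)).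
rewrite (inH_inv hf vN vL iL); apply/eqP; apply: contraT => nf.
have := leq_trans le sL; rewrite leq_eqVlt => /orP[/eqP sd|lt].
  case: (H _ vL nf); exists Ls; split=> //; last exact: isob_refl.
  apply: P_bigsum => //; have /inHE[_ h _ _] := hf; exact: h.
by rewrite vf ?indec_nz ?eqxx // in nf.
Qed.

Lemma vanish_words d f : inH P f -> vanish d f -> exists a, words d f a.
Proof.
elim: d f => [|d IH] f hf vf.
  exists 0; apply: words_ext (words_nil _) => // M; rewrite /hzero; apply/esym.
  case: (boolP (valid M)) => vM; last by have [h _ _ _] := hf; exact: h.
  exact: vanish0 (inH_inv hf) vf vM.
(* The inner induction runs over a finite cover of the classes in the support that are sums of
   exactly [d] indecomposables. Once the cover is empty, the degree drops. *)
pose split_d M := exists Ns, [/\ List.Forall good Ns, size Ns = d & isob M (bigsum Ns)].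
have [gs0 Hgs0] := inH_cover hf.
have [gs Hgs] : exists gs, forall M, valid M -> f M != 0 -> split_d M -> has (isob M) gs.
  by exists gs0 => M vM nf _; exact: Hgs0.
elim: gs f hf vf Hgs {gs0 Hgs0} => [|M gs IHg] f hf vf Hgs.
  have [|a Wa] := IH f hf; last by exists a; exact: words_le Wa.
  by apply: vanish_of_cover => // M vM nf sM; have := Hgs M vM nf sM.
have If := inH_inv hf; have [f0 _ _ _] := hf.
case: (classic (f M != 0 /\ split_d M)) => [[nf [Ns [gN sN iN]]]|H]; last first.
  apply: IHg => // N vN nf sN; have /orP[i|//] := Hgs N vN nf sN; case: H.
  have vM := isob_valid vN i; split; first by rewrite -(If N M).
  by have [Ns [gN sN' iN]] := sN; exists Ns; split=> //; exact: isob_trans vM (isob_sym vN i) iN.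
have vM : valid M by apply: contraNT nf => /f0->.
have nN := good_nz gN; have vN := nz_valid nN; have vb := bigsum_valid vN.
pose m : K := (matchings Ns Ns)%:R; have m0 : m != 0 := natr_neq0 (matchings_refl vN).
(* [word Ns] takes the value [m] at [M], so this multiple cancels [f] there. *)
pose f' := hadd f (hscale (- (f M / m)) (word Ns)).
have hf' : inH P f' by apply: inH_add => //; apply: inH_scale; exact: inH_word.
have If' := inH_inv hf'.
have gI := good_indec gN.
have vf' : vanish d.+1 f'.
  by apply: vanish_add => //; apply: vanish_scale; rewrite -sN; exact: word_vanish.
have f'M : f' M = 0.
  by rewrite /f' /hadd /hscale (@word_inv Q K Ns _ _ vM vb iN) word_top // mulNr -/m divfK // subrr.
have [|a Wa] := IHg f' hf' vf'.
  move=> N vN' nf' sN'; have key : ~~ isob N M.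
    by apply: contraNN nf' => i; rewrite (If' _ _ vN' vM i) f'M.
  have [fN0|nfN] := eqVneq (f N) 0; last first.
    by have /orP[i|//] := Hgs N vN' nfN sN'; rewrite i in key.
  (* The subtraction adds no class of this kind: if [f] vanishes at [N] and [f'] does not, then
     [word Ns] does not, and the resulting matching makes [N] isomorphic to [M]. *)
  have [Us [gU sU iU]] := sN'; have nU := good_nz gU; have vU := bigsum_valid (nz_valid nU).
  case/negP: key; move: nf'; rewrite /f' /hadd /hscale fN0 add0r.
  rewrite (@word_inv Q K Ns _ _ vN' vU iU) word_top ?sU ?sN // => /eqP nz0.
  have [z|pos] := posnP (matchings Ns Us); first by rewrite z mulr0 in nz0.
  apply: isob_trans iU _ => //; apply: isob_trans vU (matchings_iso _ _ pos) _ => //.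
    exact: nz_valid.
  exact: isob_sym vM iN.
exists (f M / m *: wordA Ns + a).
apply: words_ext (words_cons (f M / m) gN _ Wa) => //; last by rewrite sN.
by move=> X; rewrite /f' /hadd /hscale; ring.
Qed.

Lemma inH_words f : inH P f -> exists d a, words d f a.
Proof.
move=> hf; have /inHE[_ _ _ [D HD]] := hf.
(* The product bounds the total dimension on the support, hence the number of non-zero summands. *)
exists (#|qvert Q| * D).+1%N; apply: vanish_words => // Ns nN le.
have vN := bigsum_valid (nz_valid nN).
apply/eqP; apply: contraT => nf; have := leq_trans le (tdim_bigsum nN).
rewrite ltnNge -sum_nat_const leq_sum // => i _; exact: HD.
Qed.

(** No normal form for words is fixed, so the value is described rather than computed: [inH_words]
    gives existence and [words_fun] uniqueness. *)
Definition extension f : A := epsilon (inhabits 0) (fun a => exists d, words d f a).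

Lemma extensionP f : inH P f -> exists d, words d f (extension f).
Proof.
move=> /inH_words[d [a W]]; apply: (epsilon_spec (inhabits 0) (fun a => exists d, words d f a)).
by exists a, d.
Qed.

Lemma extension_eq d f a : inH P f -> words d f a -> extension f = a.
Proof. by move=> /extensionP[e We]; exact: words_fun We. Qed.

Lemma extension_alg : alg_map_on P extension.
Proof.
split.
- apply: (@extension_eq 1); first exact: inH_one.
  exact: (@words_word 1 [::]).
- move=> f g hf hg; have [d Wf] := extensionP hf; have [e Wg] := extensionP hg.
  apply: (@extension_eq (maxn d e)); first exact: inH_add.
  by apply: words_add; [apply: words_le Wf; exact: leq_maxl | apply: words_le Wg; exact: leq_maxr].
- move=> c f hf; have [d Wf] := extensionP hf.
  by apply: extension_eq (words_scale c Wf); exact: inH_scale.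
- move=> f g hf hg; have [d Wf] := extensionP hf; have [e Wg] := extensionP hg.
  by apply: extension_eq (words_mul Wf Wg); exact: inH_mul.
Qed.

Lemma words_of_span x : indec_span P x -> words 2 x (phi x).
Proof.
move=> sx; have := words_span sx (List.Forall_nil good) (ltn0Sn 0); rewrite mulr1.
have [hx _] := (prim_span P_iso x).2 sx; have [h0 _ _ _] := hx.
apply: words_ext => // M; case: (boolP (valid M)) => vM; last by rewrite hmul_nonvalid // h0.
by rewrite hmulr1 //; exact: inH_inv hx.
Qed.

Lemma extension_prim x : prim x -> extension x = phi x.
Proof. by move=> px; apply: extension_eq (words_of_span _); [case: px | apply/(prim_span P_iso)]. Qed.

Lemma alg_map_words Phi d f a : alg_map_on P Phi -> (forall x, prim x -> Phi x = phi x) ->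
  words d f a -> inH P f /\ Phi f = a.
Proof.
move=> [P1 PD PZ PM] Pn.
have Pw w : List.Forall good w -> Phi (word w) = wordA w.
  elim=> //= N {}w gN gw IH; have [vN PN _] := gN.
  by rewrite PM ?IH ?Pn //; [exact: prim_delta | exact: inH_delta | exact: inH_word].
elim=> [|c w {}f {}a gw _ _ [hf ef]].
  by split; [exact: inH_zero | rewrite Pn ?phi0 //; split; [exact: inH_zero | exact: primitive0]].
have hw : inH P (word w) by exact: inH_word.
split; first by apply: inH_add => //; exact: inH_scale.
by rewrite PD ?PZ ?Pw ?ef //; exact: inH_scale.
Qed.
End Target.

Lemma prim_UEA : is_UEA P (fun x : rep Q -> K => prim x).
Proof.
move=> A phi phiL; split.
  by exists (extension phi); split; [exact: extension_alg | exact: extension_prim].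
move=> Phi1 Phi2 a1 a2 e1 e2 x hx; have [d [a W]] := inH_words phi hx.
have [_ ->] := alg_map_words phiL a1 e1 W.
by have [_ ->] := alg_map_words phiL a2 e2 W.
Qed.

Lemma hall_bialg : @bialg_compat Q K P.
Proof.
split.
- move=> f g hf hg A B; rewrite /coprod /tmul; case: ifP => // /andP[vA vB].
  rewrite hmul_dsum //; [|exact: inH_inv hf|exact: inH_inv hg].
  apply: eq_bigr => S sS; apply: eq_bigr => T sT.
  by rewrite !quo_valid // !sub_valid.
- move=> A B; rewrite /coprod /hone; case: (boolP (valid A)) => [vA|]; last by rewrite mul0r.
  case: (boolP (valid B)) => [vB|]; last by rewrite mulr0.
  by rewrite dsum_valid // isZero_dsum /= -natrM mulnb.
- by move=> f g hf hg; apply: hmul_rep0; [exact: inH_inv hf|exact: inH_inv hg].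
- by rewrite /hone rep0_valid rep0_zero.
Qed.

Lemma hall_UEA : @hall_UEA_claim Q K P.
Proof.
split; [|exact: prim_UEA|exact: hall_bialg].
by move=> x; rewrite indec_spanP; exact: prim_span.
Qed.
End Envelope.

Theorem mainTheorem10 (Q : quiver) (K : fieldType) (charK0 : [pchar K] =i pred0) :
  @hall_UEA_claim Q K (fun _ => True) /\ @hall_UEA_claim Q K (@nilpotent Q).
Proof.
split; apply: hall_UEA => //.
- exact: nilp_zero.
- exact: nilp_iso.
- exact: nilp_dsum.
- exact: nilp_ext.
Qed.
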